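(* Let $\omega$ be a connection form. The covariant derivative $(e,L)\mapsto\nabla^{(\omega)}_eL$ makes $\overline{\mathfrak g}$ a Lie module over $\mathcal L$; that is, $\nabla^{(\omega)}_eL\in\overline{\mathfrak g}$ for all $e\in\mathcal L$, $L\in\overline{\mathfrak g}$, and $\nabla^{(\omega)}_{[e,f]}=[\nabla^{(\omega)}_e,\nabla^{(\omega)}_f]$ for all $e,f\in\mathcal L$.
   Context: Setting. $\Sigma$ is a compact Riemann surface of genus $g$ with two distinct marked points $P_+,P_-$; $n\in\mathbb N$; $W=\{\gamma_1,\dots,\gamma_{ng}\}\subset\Sigma\setminus\{P_+,P_-\}$ is a set of $ng$ further points, all marked points being in generic position; $z_s$ is a fixed local coordinate centred at $\gamma_s$. $\mathfrak g$ is one of the complex matrix Lie algebras $\mathfrak{gl}(n)$, $\mathfrak{sl}(n)$, $\mathfrak{so}(n)$ (skew-symmetric matrices), $\mathfrak{sp}(2n)=\{X: X^t\sigma+\sigma X=0\}$ ($\sigma$ a nondegenerate skew-symmetric $2n\times 2n$ matrix), $\mathfrak s(n)$ (scalar $n\times n$ matrices). To each $\gamma_s$ a vector $\alpha_s\in\mathbb C^n$ is attached ($\alpha_s\in\mathbb C^{2n}$ for $\mathfrak{sp}(2n)$; $\alpha_s^t\alpha_s=0$ for $\mathfrak{so}(n)$). Lax operator algebra. $\overline{\mathfrak g}$ is the Lie algebra, under the pointwise commutator, of all meromorphic $L:\Sigma\to\mathfrak g$, holomorphic outside $W\cup\{P_+,P_-\}$, whose Laurent expansion $L=\sum_k L_{s,k}z_s^k$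 at each $\gamma_s$ satisfies: for $\mathfrak{gl}(n),\mathfrak{sl}(n)$: $L_{s,k}=0$ for $k<-1$ and there are $\beta_s\in\mathbb C^n,\kappa_s\in\mathbb C$ with $L_{s,-1}=\alpha_s\beta_s^t$, $\beta_s^t\alpha_s=0$, $L_{s,0}\alpha_s=\kappa_s\alpha_s$; for $\mathfrak{so}(n)$: the same with $L_{s,-1}=\alpha_s\beta_s^t-\beta_s\alpha_s^t$; for $\mathfrak{sp}(2n)$: $L_{s,k}=0$ for $k<-2$ and there are $\beta_s\in\mathbb C^{2n},\nu_s,\kappa_s\in\mathbb C$ with $L_{s,-2}=\nu_s\alpha_s\alpha_s^t\sigma$, $L_{s,-1}=(\alpha_s\beta_s^t+\beta_s\alpha_s^t)\sigma$, $\beta_s^t\sigma\alpha_s=0$, $L_{s,0}\alpha_s=\kappa_s\alpha_s$, $\alpha_s^t\sigma L_{s,1}\alpha_s=0$; for $\mathfrak s(n)$: $L$ is holomorphic at $W$. $\mathcal L$ is the Lie algebra of meromorphic vector fields on $\Sigma$ holomorphic outside $\{P_+,P_-\}$. Connection forms. A connection form $\omega$ is a meromorphic matrix-valued 1-form on $\Sigma$, with values in $\mathfrak g$ for $\mathfrak{so}(n),\mathfrak{sp}(2n)$ and in $\mathfrak{gl}(n)$ for $\mathfrak{gl}(n),\mathfrak{sl}(n),\mathfrak s(n)$, holomorphic outside $W\cup\{P_-\}$ (in particular holomorphic at $P_+$), holomorphic at $\gamma_s$ if $\alpha_s=0$, and if $\alpha_s\ne0$ with expansion $\omega=(\omega_{s,-1}z_s^{-1}+\omega_{s,0}+\omega_{s,1}z_s+\cdots)dz_s$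 such that for some vector $\tilde\beta_s$ and $\tilde\kappa_s\in\mathbb C$: $\omega_{s,0}\alpha_s=\tilde\kappa_s\alpha_s$ and ($\mathfrak{gl},\mathfrak{sl},\mathfrak s$) $\omega_{s,-1}=\alpha_s\tilde\beta_s^t$, $\tilde\beta_s^t\alpha_s=1$; ($\mathfrak{so}$) $\omega_{s,-1}=\alpha_s\tilde\beta_s^t-\tilde\beta_s\alpha_s^t$, $\tilde\beta_s^t\alpha_s=1$; ($\mathfrak{sp}$) $\omega_{s,-1}=(\alpha_s\tilde\beta_s^t+\tilde\beta_s\alpha_s^t)\sigma$, $\tilde\beta_s^t\sigma\alpha_s=1$, $\alpha_s^t\sigma\omega_{s,1}\alpha_s=0$. The covariant derivative is $\nabla^{(\omega)}_eL=e\,.\,L+[\omega(e),L]$, where $e\,.\,L$ is the entrywise derivative; locally, with $e=\tilde e\frac{d}{dz}$, $\omega=\tilde\omega\,dz$, it is $\tilde e\,(\frac{dL}{dz}+[\tilde\omega,L])$. *)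

(* Defs.v *)
From HB Require Import structures.
From mathcomp Require Import all_boot all_order all_algebra.
From mathcomp Require Import complex.
From mathcomp Require Import all_classical all_reals all_analysis.
Set Implicit Arguments.
Unset Strict Implicit.
Unset Printing Implicit Defensive.
Import Order.TTheory GRing.Theory Num.Theory numFieldNormedType.Exports.
Local Open Scope classical_set_scope.
Local Open Scope ring_scope.

(* Packed as a numFieldType so that the canonical topology applies: it is the
   one given by the complex modulus, and [derive1] is the complex derivative. *)
Definition CC (R : realType) : numFieldType := R[i].

Section Expansions.
Variable R : realType.
Local Notation C := (CC R).

(* Holomorphic functions are the sums of convergent power series (Weierstrass),
   and meromorphic ones the sums of Laurent series with finite principal part. *)
Definition holomorphic (F : C -> C) (c : C) : Prop :=
  exists a : nat -> C, \forall w \near c,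
    series (fun j : nat => a j * (w - c) ^+ j) @ \oo --> F w.

(* The value F c is irrelevant; a k is the coefficient of (w - c) ^ k. *)
Definition laurent (F : C -> C) (c : C) (a : int -> C) : Prop :=
  exists m : nat,
    (forall k : int, k < - m%:Z -> a k = 0) /\
    \forall w \near c^',
      series (fun j : nat => a (j%:Z - m%:Z) * (w - c) ^ (j%:Z - m%:Z))
        @ \oo --> F w.

Definition meromorphic (F : C -> C) (c : C) : Prop :=
  exists a : int -> C, laurent F c a.

Definition mx_laurent (n : nat) (F : C -> 'M[C]_n) (c : C)
    (a : int -> 'M[C]_n) : Prop :=
  forall i j, laurent (fun w => F w i j) c (fun k => a k i j).

End Expansions.

(* [coord] is meaningful on [dom], [param] (its inverse) on [coord @` dom]. *)
Record chart (R : realType) (X : topologicalType) := Chart {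
  dom : set X;
  coord : X -> CC R;
  param : CC R -> X }.

Section Charts.
Variables (R : realType) (X : topologicalType).
Implicit Types phi psi : chart R X.

Definition is_chart phi : Prop :=
  [/\ open (dom phi), open (coord phi @` dom phi),
      forall x, dom phi x -> param phi (coord phi x) = x,
      {within dom phi, continuous (coord phi)} &
      {within coord phi @` dom phi, continuous (param phi)}].

Definition transition phi psi : CC R -> CC R := coord psi \o param phi.

Definition compatible phi psi : Prop :=
  forall x, dom phi x -> dom psi x ->
    holomorphic (transition phi psi) (coord phi x) /\
    holomorphic (transition psi phi) (coord psi x).

End Charts.

Record riemannSurface (R : realType) := RiemannSurface {
  carrier :> topologicalType;
  atlas : set (chart R carrier);
  surface_hausdorff : hausdorff_space carrier;
  surface_connected : connected [set: carrier];
  atlas_chart : forall phi, atlas phi -> is_chart phi;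
  atlas_cover : forall x, exists phi, atlas phi /\ dom phi x;
  atlas_compatible : forall phi psi, atlas phi -> atlas psi ->
    compatible phi psi;
  atlas_maximal : forall phi, is_chart phi ->
    (forall psi, atlas psi -> compatible phi psi) -> atlas phi }.

Section Tensors.
Variables (R : realType) (X : riemannSurface R).
Local Notation C := (CC R).
Implicit Types (phi psi : chart R X) (S : set X) (x p : X).

Definition chart_at x : chart R X := projT1 (cid (atlas_cover x)).

Definition local_coordinate p (z : chart R X) : Prop :=
  [/\ atlas z, dom z p & coord z p = 0].

(* Functions, vector fields and 1-forms are given by their components in all
   charts: [F phi x] is the component at [x] with respect to the coordinate of
   [phi], that is, [e = e phi x d/dz] and [omega = omega phi x dz].
   A function is a component family that does not depend on the chart.
   An object holomorphic outside S takes unspecified values on S; two such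
   objects are equal when they agree outside S. *)
Definition components := chart R X -> X -> C.

Definition holomorphic_at (F : components) p : Prop :=
  forall phi, atlas phi -> dom phi p ->
    holomorphic (F phi \o param phi) (coord phi p).

Definition meromorphic_at (F : components) p : Prop :=
  forall phi, atlas phi -> dom phi p ->
    meromorphic (F phi \o param phi) (coord phi p).

Definition mero_holo_outside S (F : components) : Prop :=
  (forall p, meromorphic_at F p) /\ (forall p, ~ S p -> holomorphic_at F p).

Definition mero_fun S (f : X -> C) : Prop := mero_holo_outside S (fun _ => f).

Definition mero_vector_field S (e : components) : Prop :=
  mero_holo_outside S e /\
  forall phi psi x, atlas phi -> atlas psi -> dom phi x -> dom psi x -> ~ S x ->
    e psi x = derive1 (transition phi psi) (coord phi x) * e phi x.

Definition mero_form S (omega : components) : Prop :=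
  mero_holo_outside S omega /\
  forall phi psi x, atlas phi -> atlas psi -> dom phi x -> dom psi x -> ~ S x ->
    omega phi x = derive1 (transition phi psi) (coord phi x) * omega psi x.

(* The genus is the dimension of the space of holomorphic 1-forms. *)
Definition has_genus (g : nat) : Prop :=
  exists theta : 'I_g -> components,
    [/\ forall i, mero_form set0 (theta i),
        forall c : 'I_g -> C,
          (forall phi x, atlas phi -> dom phi x ->
             \sum_(i < g) c i * theta i phi x = 0) ->
          forall i, c i = 0 &
        forall eta, mero_form set0 eta ->
          exists c : 'I_g -> C, forall phi x, atlas phi -> dom phi x ->
            eta phi x = \sum_(i < g) c i * theta i phi x].

Definition vf_bracket (e f : components) : components := fun phi x =>
  e phi x * derive1 (f phi \o param phi) (coord phi x)
  - f phi x * derive1 (e phi \o param phi) (coord phi x).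

Definition vf_lincomb (c : C) (e f : components) : components :=
  fun phi x => c * e phi x + f phi x.

Section MatrixValued.
Variable n : nat.

Definition mx_form := chart R X -> X -> 'M[C]_n.

(* These two do not depend on the chart, as long as e and omega transform as
   vector fields and 1-forms. *)
Definition vf_act (e : components) (L : X -> 'M[C]_n) (x : X) : 'M[C]_n :=
  let phi := chart_at x in
  e phi x *: \matrix_(i, j) derive1 (fun w => L (param phi w) i j) (coord phi x).

Definition form_eval (omega : mx_form) (e : components) (x : X) : 'M[C]_n :=
  let phi := chart_at x in e phi x *: omega phi x.

Definition commutator (A B : 'M[C]_n) : 'M[C]_n := A *m B - B *m A.

Definition nabla (omega : mx_form) (e : components) (L : X -> 'M[C]_n)
    (x : X) : 'M[C]_n :=
  vf_act e L x + commutator (form_eval omega e x) (L x).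

End MatrixValued.
End Tensors.

(* [Sp sigma] is sp(2n) for the form sigma, [Scal] is s(n). *)
Inductive matrix_lie (R : realType) (n : nat) :=
  | Gl | Sl | So | Sp of 'M[CC R]_(2 * n) | Scal.
Arguments Gl {R n}.
Arguments Sl {R n}.
Arguments So {R n}.
Arguments Scal {R n}.

Section LaxOperators.
Variables (R : realType) (n : nat).
Local Notation C := (CC R).
Implicit Type G : matrix_lie R n.

Definition mdim G : nat := if G is Sp _ then (2 * n)%N else n.

Definition well_formed G : Prop :=
  if G is Sp sigma then sigma^T = - sigma /\ sigma \in unitmx else True.

Definition lie_mem G : 'M[C]_(mdim G) -> Prop :=
  match G with
  | Gl => fun _ => True
  | Sl => fun A => \tr A = 0
  | So => fun A => A^T = - A
  | Sp sigma => fun A => A^T *m sigma + sigma *m A = 0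
  | Scal => fun A => is_scalar_mx A
  end.

Definition connection_mem G : 'M[C]_(mdim G) -> Prop :=
  match G with
  | So => lie_mem (G := So)
  | Sp sigma => lie_mem (G := Sp sigma)
  | _ => fun _ => True
  end.

Definition tyurin_vector G : 'cV[C]_(mdim G) -> Prop :=
  match G with
  | So => fun alpha => alpha^T *m alpha = 0
  | _ => fun _ => True
  end.

Definition pole_order_le m (N : nat) (a : int -> 'M[C]_m) : Prop :=
  forall k : int, k < - N%:Z -> a k = 0.

Definition lax_gl m (alpha : 'cV[C]_m) (a : int -> 'M[C]_m) : Prop :=
  pole_order_le 1 a /\
  exists (beta : 'cV[C]_m) (kappa : C),
    [/\ a (-1) = alpha *m beta^T,
        beta^T *m alpha = 0 &
        a 0 *m alpha = kappa *: alpha].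

Definition lax_expansion G :
    'cV[C]_(mdim G) -> (int -> 'M[C]_(mdim G)) -> Prop :=
  match G with
  | Gl => @lax_gl n
  | Sl => @lax_gl n
  | So => fun alpha a =>
      pole_order_le 1 a /\
      exists (beta : 'cV[C]_n) (kappa : C),
        [/\ a (-1) = alpha *m beta^T - beta *m alpha^T,
            beta^T *m alpha = 0 &
            a 0 *m alpha = kappa *: alpha]
  | Sp sigma => fun alpha a =>
      pole_order_le 2 a /\
      exists (beta : 'cV[C]_(2 * n)) (nu kappa : C),
        [/\ a (-2) = nu *: (alpha *m alpha^T *m sigma),
            a (-1) = (alpha *m beta^T + beta *m alpha^T) *m sigma,
            beta^T *m sigma *m alpha = 0,
            a 0 *m alpha = kappa *: alpha &
            alpha^T *m sigma *m a 1 *m alpha = 0]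
  | Scal => fun _ a => pole_order_le 0 a
  end.

Definition connection_gl m (alpha : 'cV[C]_m) (a : int -> 'M[C]_m) : Prop :=
  exists (beta : 'cV[C]_m) (kappa : C),
    [/\ a 0 *m alpha = kappa *: alpha,
        a (-1) = alpha *m beta^T &
        beta^T *m alpha = 1%:M].

Definition connection_residue G :
    'cV[C]_(mdim G) -> (int -> 'M[C]_(mdim G)) -> Prop :=
  match G with
  | Gl => @connection_gl n
  | Sl => @connection_gl n
  | Scal => @connection_gl n
  | So => fun alpha a =>
      exists (beta : 'cV[C]_n) (kappa : C),
        [/\ a 0 *m alpha = kappa *: alpha,
            a (-1) = alpha *m beta^T - beta *m alpha^T &
            beta^T *m alpha = 1%:M]
  | Sp sigma => fun alpha a =>
      exists (beta : 'cV[C]_(2 * n)) (kappa : C),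
        [/\ a 0 *m alpha = kappa *: alpha,
            a (-1) = (alpha *m beta^T + beta *m alpha^T) *m sigma,
            beta^T *m sigma *m alpha = 1%:M &
            alpha^T *m sigma *m a 1 *m alpha = 0]
  end.

Definition connection_expansion G (alpha : 'cV[C]_(mdim G))
    (a : int -> 'M[C]_(mdim G)) : Prop :=
  (alpha = 0 -> pole_order_le 0 a) /\
  (alpha <> 0 -> pole_order_le 1 a /\ connection_residue alpha a).

Section OnSurface.
Variables (X : riemannSurface R) (N : nat) (Pplus Pminus : X).
Variables (gamma : 'I_N -> X) (z : 'I_N -> chart R X) (G : matrix_lie R n).
Variable alpha : 'I_N -> 'cV[C]_(mdim G).

Definition lax_singular : set X := range gamma `|` [set Pplus; Pminus].

Definition lax_operator (L : X -> 'M[C]_(mdim G)) : Prop :=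
  [/\ forall i j, mero_fun lax_singular (fun x => L x i j),
      forall x, ~ lax_singular x -> lie_mem (L x) &
      forall s, exists a : int -> 'M[C]_(mdim G),
        mx_laurent (L \o param (z s)) 0 a /\ lax_expansion (alpha s) a].

Definition KN_vector_field (e : components X) : Prop :=
  mero_vector_field [set Pplus; Pminus] e.

Definition connection_singular : set X := range gamma `|` [set Pminus].

Definition connection_form (omega : mx_form X (mdim G)) : Prop :=
  [/\ forall i j,
        mero_form connection_singular (fun phi x => omega phi x i j),
      forall phi x, atlas phi -> dom phi x -> ~ connection_singular x ->
        connection_mem (omega phi x) &
      forall s, exists a : int -> 'M[C]_(mdim G),
        mx_laurent (omega (z s) \o param (z s)) 0 a /\
        connection_expansion (alpha s) a].

End OnSurface.
End LaxOperators.

(* Main.v *)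
Require Import Defs.
From HB Require Import structures.
From mathcomp Require Import all_boot all_order all_algebra.
From mathcomp Require Import complex.
From mathcomp Require Import all_classical all_reals all_analysis.
From mathcomp Require Import ring lra zify.
Set Implicit Arguments.
Unset Strict Implicit.
Unset Printing Implicit Defensive.
Import Order.TTheory GRing.Theory Num.Theory numFieldNormedType.Exports.
(* [coord] denotes the coordinate of a chart, not coordinates in a basis. *)
Import Defs.
Local Open Scope classical_set_scope.
Local Open Scope ring_scope.

(** Away from the marked points everything is holomorphic. In a chart with
    coordinate z, where e = E d/dz and omega = Om dz, the covariant derivative
    is E (dL/dz + [Om, L]). By the chain rule E Om and E d/dz do not depend on
    the chart ([nabla_chartE]), so [nabla], which is computed in a chart chosen
    separately at every point, may be differentiated as if it were given by
    this formula in a single chart.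

    The module identity is then local: with N = dL/dz + [Om, L],
    nabla_e (nabla_f L) = E (F' N + F N' + F [Om, N]), and the last two terms
    cancel after antisymmetrization in e and f, leaving (E F' - F E') N
    ([nabla_bracket]).

    The content of the statement is that nabla_e L satisfies the local
    conditions of a Lax operator at every gamma_s. In terms of Laurent
    coefficients it is a finite computation with the rank one matrices built
    from alpha, beta and the vector t in the residue of omega. The derivative
    would raise the order of the pole, and the normalization t^T alpha = 1 is
    exactly what makes the residue of omega compensate it; the same mechanism
    gives the eigenvector condition on the constant term. For so(n) and sp(2n)
    the computation is done once, for a bilinear form sigma with sigma^T = eps
    sigma and eps = 1 or -1 ([metric_lax_nabla]); gl(n) and sl(n) are treated
    by [gl_lax_nabla], and for scalar matrices the bracket vanishes.
    Multiplication by the holomorphic component E of e preserves the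
    conditions ([gl_lax_scale], [metric_lax_scale]).

    To apply this, Laurent expansions must be multiplied, differentiated and
    shown to be unique. All this reduces to convergent power series over the
    complex numbers: the coefficients satisfy Cauchy bounds |b_j| r^j <= M, and
    on the disc of radius r/4 every series involved is dominated by a geometric
    one. This gives the Cauchy product ([psum_mul]) and termwise
    differentiation ([near_psum_derive]), hence uniqueness of the coefficients
    ([laurent_unique0]). Uniqueness also shows that the Laurent coefficients of
    a g-valued function lie in g, which the computations for so(n), sp(2n) and
    the scalar matrices use. *)

(** * Power series at a point *)

Section PowerSeries.
Variable K : numFieldType.

Definition psum (b : nat -> K) (u l : K) : Prop :=
  series (fun j => b j * u ^+ j) @ \oo --> l.

Lemma psumD a b u k l : psum a u k -> psum b u l ->
  psum (fun j => a j + b j) u (k + l).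
Proof.
move=> h h'; rewrite /psum.
have -> : series (fun j => (a j + b j) * u ^+ j) =
    (series (fun j => a j * u ^+ j) \+ series (fun j => b j * u ^+ j)).
  apply/funext => n; rewrite /series /= -big_split /=.
  by apply: eq_bigr => i _; rewrite mulrDl.
exact: cvgD.
Qed.

Lemma psumZ (k : K) b u l : psum b u l -> psum (fun j => k * b j) u (k * l).
Proof.
move=> h; rewrite /psum.
have -> : series (fun j => k * b j * u ^+ j) =
    (fun n => k * series (fun j => b j * u ^+ j) n).
  apply/funext => n; rewrite /series /= mulr_sumr.
  by apply: eq_bigr => i _; rewrite mulrA.
by apply: cvgM => //; exact: cvg_cst.
Qed.

Lemma psum0 u : psum (fun=> 0) u 0.
Proof.
rewrite /psum.
have -> : series (fun j => (0 : K) * u ^+ j) = cst 0.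
  by apply/funext => n; rewrite /series /= big1// => i _; rewrite mul0r.
exact: cvg_cst.
Qed.

Lemma psum_at0 (b : nat -> K) : psum b 0 (b 0%N).
Proof.
rewrite /psum -(cvg_shiftS _ _).
have -> : (fun n => series (fun j => b j * 0 ^+ j) n.+1) = cst (b 0%N).
  apply/funext => n; rewrite /series /= big_nat_recl//= expr0 mulr1 big1 ?addr0//.
  by move=> i _; rewrite expr0n mulr0.
exact: cvg_cst.
Qed.

Lemma psum_mulX b u l :
  psum b u l -> psum (fun j => if j is k.+1 then b k else 0) u (u * l).
Proof.
move=> h; rewrite /psum -(cvg_shiftS _ _).
have -> : (fun n => series (fun j => (if j is k.+1 then b k else 0) * u ^+ j) n.+1) =
    (fun n => u * series (fun j => b j * u ^+ j) n).
  apply/funext => n; rewrite /series /= big_nat_recl//= mul0r add0r mulr_sumr.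
  by apply: eq_bigr => i _; rewrite exprS mulrCA.
by apply: cvgM => //; exact: cvg_cst.
Qed.

Lemma psum_divX b u l : u != 0 ->
  psum b u l -> psum (fun j => b j.+1) u (u^-1 * (l - b 0%N)).
Proof.
move=> u0 h; rewrite /psum.
have -> : series (fun j => b j.+1 * u ^+ j) =
    (fun n => u^-1 * (series (fun j => b j * u ^+ j) n.+1 - b 0%N)).
  apply/funext => n; rewrite /series /= big_nat_recl//= expr0 mulr1 addrC addKr.
  rewrite mulr_sumr; apply: eq_bigr => i _.
  by rewrite exprS [b i.+1 * (_ * _)]mulrCA mulKf.
apply: cvgM; first exact: cvg_cst.
apply: cvgB; last exact: cvg_cst.
by move: h; rewrite /psum -(cvg_shiftS _ _).
Qed.

Lemma cvg_seqM (u v : nat -> K) (k l : K) :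
  u @ \oo --> k -> v @ \oo --> l -> (fun n => u n * v n) @ \oo --> k * l.
Proof. exact: cvgM. Qed.

Lemma cvg_seqB (u v : nat -> K) (k l : K) :
  u @ \oo --> k -> v @ \oo --> l -> (fun n => u n - v n) @ \oo --> k - l.
Proof. exact: cvgB. Qed.

Lemma cvg_seqZ (k : K) (v : nat -> K) (l : K) :
  v @ \oo --> l -> (fun n => k * v n) @ \oo --> k * l.
Proof. by apply: cvg_seqM; exact: cvg_cst. Qed.

Lemma cvg_series0 (u : nat -> K) (l : K) :
  series u @ \oo --> l -> u @ \oo --> (0 : K).
Proof. by move=> h; apply: cvg_series_cvg_0; apply/cvg_ex; exists l. Qed.

Lemma cvg_seq_eq (u v : nat -> K) (l : K) :
  u =1 v -> u @ \oo --> l -> v @ \oo --> l.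
Proof. by move=> /funext ->. Qed.

End PowerSeries.

(** * Estimates for complex power series *)

Section Modulus.
Variable R : realType.
Local Notation C := (CC R).

(** The norm of [CC R] takes values in [CC R], which is only partially
    ordered; the estimates need the modulus as a real number. *)
Definition cmod (x : C) : R := ComplexField.Normc.normc x.

Lemma normE (x : C) : `|x| = (real_complex R (cmod x) : C).
Proof. by []. Qed.

Lemma cmod_ge0 x : 0 <= cmod x.
Proof. by case: x => a b; rewrite /cmod /= sqrtr_ge0. Qed.

Lemma cmodM x y : cmod (x * y) = cmod x * cmod y.
Proof. exact: ComplexField.Normc.normcM. Qed.

Lemma cmodD x y : cmod (x + y) <= cmod x + cmod y.
Proof. exact: le_normcD. Qed.

Lemma cmod0 : cmod 0 = 0.
Proof. exact: ComplexField.Normc.normc0. Qed.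

Lemma cmod1 : cmod 1 = 1.
Proof. exact: ComplexField.Normc.normc1. Qed.

Lemma cmodN x : cmod (- x) = cmod x.
Proof. exact: normcN. Qed.

Lemma cmodX x n : cmod (x ^+ n) = cmod x ^+ n.
Proof. by elim: n => [|n IH]; rewrite ?expr0 ?cmod1 // !exprS cmodM IH. Qed.

Lemma cmodV x : cmod x^-1 = (cmod x)^-1.
Proof. exact: ComplexField.Normc.normcV. Qed.

Lemma cmod_eq0 x : (cmod x == 0) = (x == 0).
Proof.
apply/eqP/eqP => [/ComplexField.Normc.eq0_normc//|->]; exact: cmod0.
Qed.

Lemma cmod_gt0 x : (0 < cmod x) = (x != 0).
Proof. by rewrite lt_neqAle cmod_ge0 andbT eq_sym cmod_eq0. Qed.

Lemma cmodB x y : cmod (x - y) = cmod (y - x).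
Proof. by rewrite -cmodN opprB. Qed.

Lemma cmod_nat n : cmod n%:R = n%:R.
Proof.
by apply: (@complexI R); rewrite -normE normr_nat (rmorph_nat (real_complex R)).
Qed.

Lemma cmod_sum (I : Type) (s : seq I) (P : pred I) (F : I -> C) :
  cmod (\sum_(i <- s | P i) F i) <= \sum_(i <- s | P i) cmod (F i).
Proof.
elim/big_rec2 : _ => [|i y x _ h]; first by rewrite cmod0.
by rewrite (le_trans (cmodD _ _))// lerD2l.
Qed.

(** Makes it possible to quantify over real radii only: a positive element of
    [CC R] is automatically real. *)
Lemma nbhsCP (c : C) (P : set C) :
  (\forall w \near c, P w) <->
  exists2 r : R, 0 < r & forall w, cmod (w - c) < r -> P w.
Proof.
split=> [/nbhs_ballP[e /= e0 eP]|[r r0 rP]].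
  have [eR e0'] : (complex.Im e == 0) /\ 0 < complex.Re e.
    by move: e0; rewrite ltcE /= eq_sym => /andP[? ?].
  have ee : e = (real_complex R (complex.Re e) : C).
    by case: (e) eR => a b /= /eqP ->.
  exists (complex.Re e) => // w wc; apply: eP.
  rewrite /ball /= normE ee ltcR; by rewrite -opprB cmodN.
apply/nbhs_ballP; exists (real_complex R r : C) => /=; first by rewrite ltcR.
move=> w; rewrite /ball /= normE ltcR => wc; apply: rP.
by rewrite -opprB cmodN.
Qed.

Lemma dnbhsCP (c : C) (P : set C) :
  (\forall w \near c^', P w) <->
  exists2 r : R, 0 < r & forall w, w != c -> cmod (w - c) < r -> P w.
Proof.
have -> : (\forall w \near c^', P w) = (\forall w \near c, w != c -> P w) by [].
split=> [/nbhsCP[r r0 rP]|[r r0 rP]].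
  by exists r => // w wc wr; exact: rP.
by apply/nbhsCP; exists r => // w wr wc; exact: rP.
Qed.

Lemma cvgCP (T : Type) (F : set_system T) (FF : Filter F) (u : T -> C) (l : C) :
  u @ F --> l <->
  forall e : R, 0 < e -> \forall n \near F, cmod (u n - l) < e.
Proof.
split=> [ul e e0|h].
  have /ul : nbhs l [set w | cmod (w - l) < e] by apply/nbhsCP; exists e.
  by [].
by move=> A /= /nbhsCP[r r0 rP]; apply: filterS (h r r0) => x /rP.
Qed.

Lemma cvgC_dominated (u : nat -> C) (l : C) (r : nat -> R) :
  (forall n, cmod (u n - l) <= r n) -> r @ \oo --> 0 -> u @ \oo --> l.
Proof.
move=> ur r0; apply/cvgCP => e e0.
have /cvgrPdist_lt /(_ e e0) := r0.
apply: filterS => n; rewrite sub0r normrN => h.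
by rewrite (le_lt_trans (ur n))// (le_lt_trans (ler_norm _)).
Qed.

Lemma cmod_cvg_le (u : nat -> C) (l : C) (K : R) :
  u @ \oo --> l -> (forall n, cmod (u n) <= K) -> cmod l <= K.
Proof.
move=> ul uK; rewrite leNgt; apply/negP => Kl.
have e0 : 0 < cmod l - K by rewrite subr_gt0.
move/cvgCP : ul => /(_ _ e0) [N _ /(_ N (leqnn N))] /=.
rewrite cmodB => h; have := cmodD (l - u N) (u N); rewrite subrK.
by have := uK N; lra.
Qed.

Lemma cmod_Re_Im (x : C) :
  [/\ `|complex.Re x| <= cmod x, `|complex.Im x| <= cmod x &
    cmod x <= `|complex.Re x| + `|complex.Im x|].
Proof.
case: x => a b; rewrite /cmod /=; split.
- by rewrite -sqrtr_sqr ler_sqrt ?lerDl ?sqr_ge0// addr_ge0 ?sqr_ge0.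
- by rewrite -sqrtr_sqr ler_sqrt ?lerDr ?sqr_ge0// addr_ge0 ?sqr_ge0.
- rewrite -[leRHS]ger0_norm ?addr_ge0// -sqrtr_sqr ler_sqrt ?sqr_ge0//.
  by rewrite sqrrD !real_normK ?num_real// lerD2r lerDl mulrn_wge0// mulr_ge0.
Qed.

(** Completeness of the complex numbers in the form needed for power series;
    it follows from that of the reals applied to real and imaginary parts. *)
Lemma series_dominated (a : nat -> C) (t : nat -> R) :
  (forall j, cmod (a j) <= t j) -> cvgn (series t) ->
  exists l : C, series a @ \oo --> l.
Proof.
move=> at_ tc.
have part (f : {additive C -> R}) : (forall x, `|f x| <= cmod x) ->
    cvgn (series (f \o a)).
  move=> fle; apply: normed_cvg; apply: series_le_cvg tc => //= j.
    exact: le_trans (cmod_ge0 _) (at_ j).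
  exact: le_trans (fle _) (at_ j).
have ReA : additive (fun x : C => complex.Re x : R).
  by case=> a1 b1; case=> a2 b2.
have ImA : additive (fun x : C => complex.Im x : R).
  by case=> a1 b1; case=> a2 b2.
pose re := GRing.isAdditive.Build _ _ (fun x : C => complex.Re x : R) ReA.
pose im := GRing.isAdditive.Build _ _ (fun x : C => complex.Im x : R) ImA.
pose rea : {additive C -> R} := HB.pack (fun x : C => complex.Re x : R) re.
pose ima : {additive C -> R} := HB.pack (fun x : C => complex.Im x : R) im.
have /cvg_ex[/= l1 h1] := part rea (fun x => let: And3 h _ _ := cmod_Re_Im x in h).
have /cvg_ex[/= l2 h2] := part ima (fun x => let: And3 _ h _ := cmod_Re_Im x in h).
exists (Complex l1 l2 : C); apply/cvgCP => e e0.
have e2 : 0 < e / 2 by lra.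
move/cvgrPdist_lt : h1 => /(_ _ e2) H1; move/cvgrPdist_lt : h2 => /(_ _ e2) H2.
near=> n.
have k1 : `|l1 - series (rea \o a) n| < e / 2 by near: n.
have k2 : `|l2 - series (ima \o a) n| < e / 2 by near: n.
have [_ _ le] := cmod_Re_Im (series a n - (Complex l1 l2 : C)).
apply: le_lt_trans le _.
have -> : complex.Re (series a n - (Complex l1 l2 : C)) = series (rea \o a) n - l1.
  rewrite -[LHS]/(rea (series a n - (Complex l1 l2 : C))) raddfB /series /=.
  by rewrite -[complex.Re _]/(rea _) raddf_sum.
have -> : complex.Im (series a n - (Complex l1 l2 : C)) = series (ima \o a) n - l2.
  rewrite -[LHS]/(ima (series a n - (Complex l1 l2 : C))) raddfB /series /=.
  by rewrite -[complex.Im _]/(ima _) raddf_sum.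
by rewrite (distrC _ l1) (distrC _ l2); lra.
Unshelve. all: by end_near. Qed.


Definition cauchy_bound (b : nat -> C) (M r : R) : Prop :=
  0 < r /\ forall j, cmod (b j) * r ^+ j <= M.

Lemma cauchy_bound_ge0 b M r : cauchy_bound b M r -> 0 <= M.
Proof. by case=> r0 /(_ 0); rewrite expr0 mulr1; apply: le_trans; exact: cmod_ge0. Qed.

(** The terms of a convergent series tend to zero, hence are bounded. *)
Lemma psum_cauchy_bound b u l : u != 0 -> psum b u l ->
  exists M, cauchy_bound b M (cmod u).
Proof.
move=> u0 bul.
have /(cvgCP _)/(_ 1 ltr01) [N _ NP] : (fun j => b j * u ^+ j) @ \oo --> (0 : C).
  exact: (cvg_series0 bul).
exists (1 + \sum_(i < N) cmod (b i) * cmod u ^+ i); split=> [|j].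
  by rewrite cmod_gt0.
case: (ltnP j N) => jN.
  rewrite (bigD1 (Ordinal jN))//= addrCA lerDl addr_ge0// sumr_ge0// => i _.
  by rewrite mulr_ge0 ?exprn_ge0 ?cmod_ge0.
have := NP j jN; rewrite /= subr0 cmodM cmodX => /ltW h.
apply: (le_trans h); rewrite lerDl sumr_ge0// => i _.
by rewrite mulr_ge0 ?exprn_ge0 ?cmod_ge0.
Qed.

Lemma near_psum_cauchy_bound b (f : C -> C) (c : C) :
  (\forall w \near c^', psum b (w - c) (f w)) ->
  exists M r, cauchy_bound b M r.
Proof.
move=> /dnbhsCP[r r0 h].
have e : cmod (real_complex R (r / 2) : C) = r / 2.
  by rewrite /cmod /= expr0n addr0 sqrtr_sqr ger0_norm//; lra.
pose u : C := c + (real_complex R (r / 2) : C).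
have uc : u - c = (real_complex R (r / 2) : C) by rewrite /u addrC addKr.
have u0 : u - c != 0 by rewrite uc -cmod_eq0 e; lra.
have u0' : u != c by rewrite -subr_eq0.
have ur : cmod (u - c) < r by rewrite uc e; lra.
have [M hM] := psum_cauchy_bound u0 (h u u0' ur).
by exists M, (cmod (u - c)).
Qed.

Lemma cauchy_boundW b M r M' : cauchy_bound b M r -> M <= M' -> cauchy_bound b M' r.
Proof. by case=> r0 h MM; split=> // j; exact: le_trans (h j) MM. Qed.

Lemma cauchy_bound_le b M r r' : cauchy_bound b M r -> 0 < r' <= r -> cauchy_bound b M r'.
Proof.
case=> r0 h /andP[r'0 rr]; split=> // j; apply: le_trans (h j).
by rewrite ler_wpM2l ?cmod_ge0// lerXn2r// nnegrE ltW.
Qed.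

Lemma near_psum_common_bound a b (f g : C -> C) (c : C) :
  (\forall w \near c^', psum a (w - c) (f w)) ->
  (\forall w \near c^', psum b (w - c) (g w)) ->
  exists M r, cauchy_bound a M r /\ cauchy_bound b M r.
Proof.
move=> /near_psum_cauchy_bound[M1 [r1 h1]] /near_psum_cauchy_bound[M2 [r2 h2]].
have r1p : 0 < r1 by case: h1.
have r2p : 0 < r2 by case: h2.
have M1p := cauchy_bound_ge0 h1; have M2p := cauchy_bound_ge0 h2.
have rp : 0 < Num.min r1 r2 by rewrite lt_min r1p r2p.
exists (M1 + M2), (Num.min r1 r2); split.
  apply: (cauchy_boundW (cauchy_bound_le h1 _)); last by rewrite lerDl.
  by rewrite rp ge_min lexx.
apply: (cauchy_boundW (cauchy_bound_le h2 _)); last by rewrite lerDr.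
by rewrite rp ge_min lexx orbT.
Qed.

Lemma geometric_half_sum n : series (fun j => 2^-1 ^+ j : R) n <= 2.
Proof.
suff -> : series (fun j => 2^-1 ^+ j : R) n = 2 - 2 * 2^-1 ^+ n.
  by rewrite gerBl mulr_ge0// exprn_ge0// invr_ge0.
rewrite /series /=; elim: n => [|n IH]; first by rewrite big_geq// expr0 mulr1 subrr.
by rewrite big_nat_recr//= IH exprS; lra.
Qed.

Lemma geometric_half_cvg : cvgn (series (fun j => 2^-1 ^+ j : R)).
Proof.
apply: nondecreasing_is_cvgn.
  by apply: nondecreasing_series => n _ _; rewrite exprn_ge0// invr_ge0.
by exists 2 => _ [n _ <-]; exact: geometric_half_sum.
Qed.

(** Radius r/4 rather than r/2 leaves a spare factor 2^-j, which absorbs the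
    polynomial factors in j that come from products and derivatives. *)
Lemma cauchy_bound_term b M r u j : cauchy_bound b M r -> cmod u <= r / 4 ->
  cmod (b j * u ^+ j) <= M * 4^-1 ^+ j.
Proof.
case=> r0 h ur; rewrite cmodM cmodX.
apply: (@le_trans _ _ (cmod (b j) * (r / 4) ^+ j)).
  by rewrite ler_wpM2l ?cmod_ge0// lerXn2r// nnegrE ?cmod_ge0//; lra.
by rewrite exprMn mulrA ler_wpM2r// exprn_ge0// invr_ge0.
Qed.

Definition cauchy_product (a b : nat -> C) (n : nat) : C :=
  \sum_(i < n.+1) a i * b (n - i)%N.

(** With x_j = a_j u^j and y_j = b_j u^j, the product of the N-th partial sums
    exceeds the N-th partial sum of the Cauchy product by the sum of the x_i
    y_j with i, j < N <= i + j. This is at most 2 M^2 N 4^-N <= 2 M^2 2^-N. *)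
Lemma psum_mul a b M r u k l : cauchy_bound a M r -> cauchy_bound b M r ->
  cmod u <= r / 4 -> psum a u k -> psum b u l -> psum (cauchy_product a b) u (k * l).
Proof.
move=> ha hb ur hk hl.
have M0 := cauchy_bound_ge0 ha.
pose x j := a j * u ^+ j; pose y j := b j * u ^+ j.
have xM j : cmod (x j) <= M * 4^-1 ^+ j := cauchy_bound_term j ha ur.
have yM j : cmod (y j) <= M * 4^-1 ^+ j := cauchy_bound_term j hb ur.
have eC N : series (fun j => cauchy_product a b j * u ^+ j) N =
    \sum_(i < N) x i * \sum_(j < N - i) y j.
  rewrite /series /=; elim: N => [|N IH]; first by rewrite big_geq// big_ord0.
  rewrite big_nat_recr//= IH big_ord_recr/= subSn// subnn.
  rewrite big_ord_recl big_ord0 addr0.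
  rewrite /cauchy_product big_ord_recr/= subnn mulrDl addrA; congr (_ + _); last first.
    by rewrite /x /y expr0 mulr1 mulrAC.
  rewrite mulr_suml -big_split/=; apply: eq_bigr => i _.
  rewrite subSn 1?ltnW// big_ord_recr/= mulrDr; congr (_ + _).
  rewrite /x /y mulrACA -exprD subnKC//; exact: ltnW.
have cp : (fun N => series x N * series y N) @ \oo --> k * l := cvg_seqM hk hl.
have d0 : (fun N => series x N * series y N -
      series (fun j => cauchy_product a b j * u ^+ j) N) @ \oo --> (0 : C).
  apply: (@cvgC_dominated _ _ (fun N => 2 * M ^+ 2 * 2^-1 ^+ N)) => [N|]; last first.
    rewrite -[X in _ --> X](mulr0 (2 * M ^+ 2)).
    by apply: cvgM; [exact: cvg_cst|apply: cvg_expr; rewrite ger0_norm; lra].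
  rewrite subr0 eC /series /= !big_mkord mulr_suml -sumrB.
  apply: (le_trans (cmod_sum _ _ _)).
  (* The bound is shared equally among the N rows; the last summand only
     accounts for N = 0, where there is no row. *)
  have -> : 2 * M ^+ 2 * 2^-1 ^+ N =
      (\sum_(i < N) (2 * M ^+ 2 * 2^-1 ^+ N / N%:R)) +
      (N == 0%N)%:R * (2 * M ^+ 2).
    rewrite sumr_const card_ord; case: N => [|N].
      by rewrite mulr0n add0r mul1r expr0 mulr1.
    by rewrite mul0r addr0 -[RHS]mulr_natr mulfVK// pnatr_eq0.
  apply: (@le_trans _ _ (\sum_(i < N) (2 * M ^+ 2 * 2^-1 ^+ N / N%:R))); last first.
    by rewrite lerDl mulr_ge0// mulr_ge0// exprn_ge0.
  apply: ler_sum => i _.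
  have iN : (i <= N)%N by exact: ltnW.
  rewrite -mulrBr cmodM.
  have -> : \sum_(j < N) y j - \sum_(j < N - i) y j = \sum_(N - i <= j < N) y j.
    rewrite -!(big_mkord xpredT y) (@big_cat_nat _ _ _ (N - i)%N 0%N N)//= ?leq_subr//.
    by rewrite [X in X - _]addrC addrK.
  have tail : cmod (\sum_(N - i <= j < N) y j) <= M * 2 * 4^-1 ^+ (N - i).
    apply: (le_trans (cmod_sum _ _ _)).
    have e : (N - i <= N)%N := leq_subr _ _.
    rewrite -{1}[(N - i)%N]add0n big_addn subKn//.
    apply: (@le_trans _ _ (\sum_(0 <= j < i) M * 4^-1 ^+ (N - i) * 2^-1 ^+ j)).
      apply: ler_sum => j _; apply: (le_trans (yM _)).
      rewrite exprD mulrA mulrAC ler_wpM2l//.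
        by rewrite mulr_ge0// exprn_ge0// invr_ge0.
      by rewrite lerXn2r// ?nnegrE; lra.
    rewrite -mulr_sumr [leRHS]mulrAC ler_wpM2l ?geometric_half_sum//.
    by rewrite mulr_ge0// exprn_ge0// invr_ge0.
  apply: (@le_trans _ _ (M * 4^-1 ^+ i * (M * 2 * 4^-1 ^+ (N - i)))).
    by apply: ler_pM; rewrite ?cmod_ge0.
  have -> : M * 4^-1 ^+ i * (M * 2 * 4^-1 ^+ (N - i)) = 2 * M ^+ 2 * 4^-1 ^+ N.
    by rewrite mulrACA -exprD subnKC// expr2; ring.
  rewrite -[leRHS]mulrA ler_wpM2l ?mulr_ge0 ?exprn_ge0//.
  have N0 : (0 < N)%N by exact: leq_trans (ltn_ord i).
  rewrite ler_pdivlMr ?ltr0n//.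
  have -> : (4^-1 : R) = 2^-1 * 2^-1 by lra.
  rewrite exprMn -mulrA ler_piMr// ?exprn_ge0// ?invr_ge0//.
  rewrite exprVn ler_pdivrMl ?exprn_gt0// mulr1.
  by rewrite -natrX ler_nat ltnW// ltn_expl.
have := cvg_seqB cp d0; rewrite subr0; apply: cvg_seq_eq => N.
by rewrite opprB addrC subrK.
Qed.


(** Writing E_j for the remainder, E_(j+1) = (u + h) E_j + j h^2 u^(j-1), so
    that the bound follows by induction from j <= 2^j. Stating it with the
    factor rho^2 on the left avoids negative powers of rho for j < 2. *)
Lemma taylor_remainder_bound (u h : C) (rho : R) (j : nat) :
  cmod u <= rho -> cmod (u + h) <= rho ->
  cmod ((u + h) ^+ j - u ^+ j - j%:R * h * u ^+ j.-1) * rho ^+ 2 <=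
    cmod h ^+ 2 * (2 * rho) ^+ j.
Proof.
move=> ur uhr; have rho0 : 0 <= rho := le_trans (cmod_ge0 u) ur.
elim: j => [|j IH].
  by rewrite !expr0 subrr !mul0r subrr cmod0 mul0r mulr1 exprn_ge0// cmod_ge0.
pose E := (u + h) ^+ j - u ^+ j - j%:R * h * u ^+ j.-1.
have -> : (u + h) ^+ j.+1 - u ^+ j.+1 - j.+1%:R * h * u ^+ j =
    (u + h) * E + j%:R * h ^+ 2 * u ^+ j.-1.
  rewrite /E; case: j {IH E} => [|j] /=; first by rewrite !expr0 !expr1; ring.
  by rewrite !exprS -!natr1; ring.
have h1 : cmod ((u + h) * E) * rho ^+ 2 <= rho * (cmod h ^+ 2 * (2 * rho) ^+ j).
  by rewrite cmodM -mulrA ler_pM ?cmod_ge0// mulr_ge0 ?cmod_ge0// exprn_ge0.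
have h2 : cmod (j%:R * h ^+ 2 * u ^+ j.-1) * rho ^+ 2 <=
    rho * (cmod h ^+ 2 * (2 * rho) ^+ j).
  rewrite !cmodM !cmodX cmod_nat.
  case: j {IH E h1} => [|j]; first by rewrite !mul0r mulr_ge0// mulr_ge0// exprn_ge0// cmod_ge0.
  rewrite [_.-1]/=.
  apply: (@le_trans _ _ (j.+1%:R * cmod h ^+ 2 * rho ^+ j * rho ^+ 2)).
    rewrite ler_wpM2r ?exprn_ge0// ler_wpM2l ?mulr_ge0 ?exprn_ge0 ?cmod_ge0//.
    by rewrite lerXn2r// nnegrE cmod_ge0.
  rewrite exprMn.
  have -> : j.+1%:R * cmod h ^+ 2 * rho ^+ j * rho ^+ 2 =
    j.+1%:R * (cmod h ^+ 2 * rho ^+ j.+2) :> R by rewrite !exprS; ring.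
  have -> : rho * (cmod h ^+ 2 * (2 ^+ j.+1 * rho ^+ j.+1)) =
    2 ^+ j.+1 * (cmod h ^+ 2 * rho ^+ j.+2) :> R by rewrite !exprS; ring.
  rewrite ler_wpM2r//; first by apply: mulr_ge0; apply: exprn_ge0; rewrite ?cmod_ge0.
  by rewrite -natrX ler_nat ltnW// ltn_expl.
apply: (@le_trans _ _
  ((cmod ((u + h) * E) + cmod (j%:R * h ^+ 2 * u ^+ j.-1)) * rho ^+ 2)).
  by rewrite ler_wpM2r ?exprn_ge0// cmodD.
rewrite mulrDl; apply: (le_trans (lerD h1 h2)).
have -> // : cmod h ^+ 2 * (2 * rho) ^+ j.+1 =
  rho * (cmod h ^+ 2 * (2 * rho) ^+ j) + rho * (cmod h ^+ 2 * (2 * rho) ^+ j).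
by rewrite [(2 * rho) ^+ j.+1]exprS; ring.
Qed.

Definition deriv_coef (b : nat -> C) (j : nat) : C := j.+1%:R * b j.+1.

Lemma psum_deriv_coef b M r u : cauchy_bound b M r -> cmod u <= r / 4 ->
  exists l, psum (deriv_coef b) u l.
Proof.
move=> hb ur; have M0 := cauchy_bound_ge0 hb; case: hb => r0 hb.
apply: (@series_dominated _ (fun j => (M * 4 / r) * 2^-1 ^+ j)); last first.
  rewrite [X in cvgn X](_ : _ = (fun n => (M * 4 / r) * series (fun j => 2^-1 ^+ j) n)).
    by apply: is_cvgM; [exact: is_cvg_cst|exact: geometric_half_cvg].
  by apply/funext => n; rewrite /series /= mulr_sumr.
move=> j; rewrite /deriv_coef !cmodM cmodX cmod_nat.
apply: (@le_trans _ _ (j.+1%:R * cmod (b j.+1) * (r / 4) ^+ j)).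
  rewrite ler_wpM2l ?mulr_ge0 ?cmod_ge0// lerXn2r// nnegrE ?cmod_ge0//; lra.
have -> : j.+1%:R * cmod (b j.+1) * (r / 4) ^+ j =
   (cmod (b j.+1) * r ^+ j.+1) * (j.+1%:R * r^-1 * 4^-1 ^+ j).
  rewrite exprMn exprS; field; lra.
apply: (@le_trans _ _ (M * (j.+1%:R * r^-1 * 4^-1 ^+ j))).
  by rewrite ler_wpM2r// !mulr_ge0// ?exprn_ge0// invr_ge0 ltW.
rewrite -!mulrA ler_wpM2l// mulrCA [leRHS]mulrCA ler_wpM2l ?invr_ge0 ?(ltW r0)//.
have -> : (4^-1 : R) = 2^-1 * 2^-1 by lra.
rewrite exprMn mulrA ler_wpM2r ?exprn_ge0 ?invr_ge0//.
rewrite exprVn ler_pdivrMr ?exprn_gt0//.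
apply: (@le_trans _ _ (2 ^+ j.+1)); first by rewrite -natrX ler_nat ltnW// ltn_expl.
by rewrite exprS ler_wpM2r ?exprn_ge0//; lra.
Qed.

(** Summing [taylor_remainder_bound] with rho = r/4 against the Cauchy bounds
    leaves a geometric series of ratio 1/2. *)
Lemma psum_taylor1 b M r u h k l d : cauchy_bound b M r ->
  cmod u <= r / 4 -> cmod (u + h) <= r / 4 ->
  psum b u k -> psum b (u + h) l -> psum (deriv_coef b) u d ->
  cmod (l - k - h * d) <= 2 * M / (r / 4) ^+ 2 * cmod h ^+ 2.
Proof.
move=> hb ur uhr hk hl hd; have M0 := cauchy_bound_ge0 hb; case: hb => r0 hb.
pose rho := r / 4; have rho0 : 0 < rho by rewrite /rho; lra.
pose T j := (u + h) ^+ j - u ^+ j - j%:R * h * u ^+ j.-1.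
have lim : (fun n => series (fun j => b j * T j) n.+1) @ \oo --> l - k - h * d.
  have hl' : (fun n => series (fun j => b j * (u + h) ^+ j) n.+1) @ \oo --> l.
    by move: hl; rewrite /psum -(cvg_shiftS _ _).
  have hk' : (fun n => series (fun j => b j * u ^+ j) n.+1) @ \oo --> k.
    by move: hk; rewrite /psum -(cvg_shiftS _ _).
  have hd' := cvg_seqZ (k := h) hd.
  apply: cvg_seq_eq (cvg_seqB (cvg_seqB hl' hk') hd') => n.
  rewrite /series /= -sumrB mulr_sumr.
  rewrite [X in _ - X](_ : _ = \sum_(0 <= j < n.+1) b j * (j%:R * h * u ^+ j.-1)).
    by rewrite -sumrB; apply: eq_bigr => j _; rewrite /T; ring.
  rewrite [RHS]big_nat_recl//= !mul0r mulr0 add0r.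
  by apply: eq_bigr => j _; rewrite /deriv_coef; ring.
apply: (cmod_cvg_le lim) => n.
apply: (le_trans (cmod_sum _ _ _)).
have TE j : cmod (b j * T j) <= (M / rho ^+ 2 * cmod h ^+ 2) * 2^-1 ^+ j.
  have := taylor_remainder_bound j ur uhr; rewrite -/(T j) -/rho => TB.
  rewrite cmodM.
  have {TB} : cmod (T j) <= cmod h ^+ 2 / rho ^+ 2 * (2 * rho) ^+ j.
    by rewrite mulrAC ler_pdivlMr ?exprn_gt0.
  move/(ler_wpM2l (cmod_ge0 (b j)))/le_trans; apply.
  have -> : 2 * rho = r * 2^-1 by rewrite /rho; lra.
  rewrite [(r * 2^-1) ^+ j]exprMn.
  have -> : cmod (b j) * (cmod h ^+ 2 / rho ^+ 2 * (r ^+ j * 2^-1 ^+ j)) =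
    (cmod (b j) * r ^+ j) * (cmod h ^+ 2 / rho ^+ 2 * 2^-1 ^+ j) by ring.
  have -> : M / rho ^+ 2 * cmod h ^+ 2 * 2^-1 ^+ j =
    M * (cmod h ^+ 2 / rho ^+ 2 * 2^-1 ^+ j) by ring.
  rewrite ler_wpM2r// !mulr_ge0 ?invr_ge0 ?exprn_ge0 ?invr_ge0 ?cmod_ge0//; exact: ltW.
apply: (le_trans (ler_sum _ (fun j _ => TE j))).
rewrite -mulr_sumr -/rho.
have -> : 2 * M / rho ^+ 2 * cmod h ^+ 2 = (M / rho ^+ 2 * cmod h ^+ 2) * 2 by ring.
rewrite ler_wpM2l ?geometric_half_sum//.
by rewrite !mulr_ge0 ?invr_ge0 ?exprn_ge0 ?cmod_ge0//; exact: ltW.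
Qed.

Lemma is_derive_quadratic (f : C -> C) (w d : C) (K r : R) : 0 < r ->
  (forall h, cmod h < r -> cmod (f (h + w) - f w - h * d) <= K * cmod h ^+ 2) ->
  is_derive w 1 f d.
Proof.
move=> r0 hK.
have lim : (fun h => h^-1 *: (f (h *: 1 + w) - f w)) @ 0^' --> d.
  apply/cvgCP => e e0.
  have K0 : 0 < `|K| + 1 by rewrite ltr_wpDl.
  apply/dnbhsCP; exists (Num.min r (e / (`|K| + 1))).
    by rewrite lt_min r0 divr_gt0.
  move=> h h0; rewrite subr0 lt_min => /andP[hr he].
  rewrite [h *: _]mulr1.
  have -> : h^-1 *: (f (h + w) - f w) - d = h^-1 * (f (h + w) - f w - h * d).
    by rewrite mulrBr mulKf.
  rewrite cmodM cmodV mulrC.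
  apply: (@le_lt_trans _ _ (K * cmod h)).
    rewrite ler_pdivrMr ?cmod_gt0// -mulrA -expr2; exact: hK.
  apply: (@le_lt_trans _ _ ((`|K| + 1) * cmod h)).
    by rewrite ler_wpM2r ?cmod_ge0// (le_trans (ler_norm _))// lerDl.
  by rewrite mulrC -ltr_pdivlMr.
by apply: DeriveDef; [apply/cvg_ex; exists d|exact: cvg_lim].
Qed.

(** Termwise differentiation. Only the first derivative at each nearby point
    is needed, so the series is never expanded around another centre. *)
Lemma near_psum_derive (b : nat -> C) (f : C -> C) (c : C) :
  (\forall w \near c, psum b (w - c) (f w)) ->
  \forall w \near c, derivable f w 1 /\ psum (deriv_coef b) (w - c) (derive1 f w).
Proof.
move=> hf; have [M [r hb]] : exists M r, cauchy_bound b M r.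
  apply: (near_psum_cauchy_bound (f := f) (c := c)).
  exact: (nbhs_dnbhs (x := c) hf).
have r0 : 0 < r by case: hb.
move/nbhsCP : hf => [s s0 hs].
apply/nbhsCP; exists (Num.min s (r / 4)); first by rewrite lt_min s0; lra.
move=> w; rewrite lt_min => /andP[ws wr].
have [d hd] := psum_deriv_coef hb (ltW wr).
have [D1 D2] : is_derive w 1 f d.
  pose t := Num.min (s - cmod (w - c)) (r / 4 - cmod (w - c)).
  have t0 : 0 < t by rewrite lt_min !subr_gt0 ws wr.
  apply: (@is_derive_quadratic f w d (2 * M / (r / 4) ^+ 2) _ t0) => h.
  rewrite lt_min => /andP[h1 h2].
  have le := cmodD (w - c) h.
  have e : h + w - c = w - c + h by rewrite addrAC addrC [h + _]addrC addrA.
  have A2 : cmod (w - c + h) <= r / 4 by lra.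
  have A3 : psum b (w - c + h) (f (h + w)) by rewrite -e; apply: hs; rewrite e; lra.
  exact: (psum_taylor1 hb (ltW wr) A2 (hs w ws) A3 hd).
split; first exact: D1.
rewrite derive1E D2; exact: hd.
Qed.

End Modulus.

(** * Derivatives of functions of one variable *)

Section HasDerivative.
Variable K : numFieldType.
Implicit Types (f g : K -> K) (x d : K).

(** Pairs derivability with the value of [derive1], so that each rule of
    differentiation transports both at once. *)
Definition has_deriv f x d : Prop := derivable f x 1 /\ derive1 f x = d.

Lemma has_derivP f x d : has_deriv f x d <-> is_derive x 1 f d.
Proof.
split=> [[h1 h2]|[h1 h2]]; first by apply: DeriveDef; rewrite // -derive1E.
by split; rewrite // derive1E.
Qed.

Lemma has_derivE f x d : has_deriv f x d -> derive1 f x = d.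
Proof. by case. Qed.

Lemma derivable_has_deriv f x : derivable f x 1 -> has_deriv f x (derive1 f x).
Proof. by []. Qed.

Lemma has_deriv_near f g x d :
  (\forall y \near x, f y = g y) -> has_deriv f x d -> has_deriv g x d.
Proof. by move=> fg /has_derivP h; apply/has_derivP; exact: near_eq_is_derive h. Qed.

Lemma derive1_near f g x :
  (\forall y \near x, f y = g y) -> derive1 f x = derive1 g x.
Proof. by move=> fg; rewrite !derive1E; exact: near_eq_derive. Qed.

Lemma has_deriv_cst k x : has_deriv (fun=> k) x 0.
Proof. by apply/has_derivP; exact: is_derive_cst. Qed.

Lemma has_deriv_shift c x : has_deriv (fun y => y - c) x 1.
Proof. by apply/has_derivP; exact: is_derive_shift. Qed.

Lemma has_derivD f g x df dg : has_deriv f x df -> has_deriv g x dg ->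
  has_deriv (fun y => f y + g y) x (df + dg).
Proof. by move=> /has_derivP h1 /has_derivP h2; apply/has_derivP; exact: is_deriveD. Qed.

Lemma has_derivM f g x df dg : has_deriv f x df -> has_deriv g x dg ->
  has_deriv (fun y => f y * g y) x (df * g x + f x * dg).
Proof.
move=> /has_derivP h1 /has_derivP h2; apply/has_derivP.
have := is_deriveM h1 h2.
by rewrite /GRing.scale /= addrC [g x * _]mulrC.
Qed.

Lemma has_derivZ (k : K) g x dg : has_deriv g x dg ->
  has_deriv (fun y => k * g y) x (k * dg).
Proof.
by move=> h; have := has_derivM (has_deriv_cst k x) h; rewrite mul0r add0r.
Qed.

Lemma has_deriv_sum (I : Type) (s : seq I) (F : I -> K -> K) x (dF : I -> K) :
  (forall i, has_deriv (F i) x (dF i)) ->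
  has_deriv (fun y => \sum_(i <- s) F i y) x (\sum_(i <- s) dF i).
Proof.
move=> h; elim: s => [|i s IH].
  rewrite big_nil; have -> : (fun y => \sum_(i <- [::]) F i y) = fun=> 0.
    by apply/funext => y; rewrite big_nil.
  exact: has_deriv_cst.
rewrite big_cons; have -> : (fun y => \sum_(j <- i :: s) F j y) =
  (fun y => F i y + \sum_(j <- s) F j y) by apply/funext => y; rewrite big_cons.
exact: has_derivD.
Qed.

Lemma has_derivX f x n df : has_deriv f x df ->
  has_deriv (fun y => f y ^+ n) x (n%:R * f x ^+ n.-1 * df).
Proof.
move=> h; elim: n => [|n IH].
  by rewrite !mul0r; have := has_deriv_cst 1 x; congr has_deriv.
have -> : (fun y => f y ^+ n.+1) = (fun y => f y * f y ^+ n).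
  by apply/funext => y; rewrite exprS.
have := has_derivM h IH; congr has_deriv => /=.
by case: n {IH} => [|n]; rewrite ?expr0 -?natr1 /= ?exprS; ring.
Qed.

Lemma derivableV1 f x : f x != 0 -> derivable f x 1 ->
  derivable (fun y => (f y)^-1) x 1.
Proof. exact: derivableV. Qed.

Lemma has_deriv_comp f g x df dg : has_deriv f x df -> has_deriv g (f x) dg ->
  has_deriv (g \o f) x (dg * df).
Proof.
move=> [/derivable1_diffP h1 <-] [/derivable1_diffP h2 <-].
have h := differentiable_comp h1 h2; split; first exact/derivable1_diffP.
rewrite derive1E'; last exact: h.
rewrite diff_comp // !derive1E' //= -[X in 'd  _ _ X = _]mulr1.
by rewrite [LHS]linearZ mulrC.
Qed.

Lemma derivable_continuous1 f x : derivable f x 1 -> f y @[y --> x] --> f x.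
Proof. by move=> /derivable1_diffP; exact: differentiable_continuous. Qed.

(** A derivable function is continuous, so its value is determined by the
    values nearby. *)
Lemma eq_of_cst_punctured (f : K -> K) x (k : K) : derivable f x 1 ->
  (\forall y \near x^', f y = k) -> f x = k.
Proof.
move=> df fk.
have h1 : f y @[y --> x^'] --> f x.
  exact: (cvg_trans (cvg_app f (nbhs_dnbhs (x := x))) (derivable_continuous1 df)).
have h2 : f y @[y --> x^'] --> k.
  apply: cvg_near_cst => //.
exact: (cvg_unique _ h1 h2).
Qed.

Lemma psum_exprz (b : nat -> K) (u l : K) (m : nat) : u != 0 ->
  (series (fun j : nat => b j * u ^ (j%:Z - m%:Z)) @ \oo --> l) <->
  psum b u (u ^+ m * l).
Proof.
move=> u0.
have e j : u ^ (j%:Z - m%:Z) = (u ^+ m)^-1 * u ^+ j.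
  by rewrite expfzDr// mulrC -exprnN.
split=> h.
  apply: cvg_seq_eq (cvg_seqZ (k := u ^+ m) h) => n.
  rewrite /series /= mulr_sumr; apply: eq_bigr => i _.
  by rewrite e mulrCA mulVKf ?expf_neq0// mulrC mulrC.
have := cvg_seqZ (k := (u ^+ m)^-1) h; rewrite mulKf ?expf_neq0//.
apply: cvg_seq_eq => n.
rewrite /series /= mulr_sumr; apply: eq_bigr => i _.
by rewrite e mulrCA.
Qed.

End HasDerivative.

(** * Calculus of Laurent expansions *)

Section Laurent.
Variable R : realType.
Local Notation C := (CC R).
Implicit Types (F G : C -> C) (c : C) (a b : int -> C).

Lemma dnbhs_mono (P Q : set C) c : (forall w, w != c -> P w -> Q w) ->
  (\forall w \near c^', P w) -> \forall w \near c^', Q w.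
Proof.
move=> PQ /dnbhsCP[r r0 h]; apply/dnbhsCP; exists r; first exact: r0.
by move=> w wc wr; apply: PQ => //; exact: h.
Qed.

Lemma dnbhs_mono2 (P Q S : set C) c : (forall w, w != c -> P w -> Q w -> S w) ->
  (\forall w \near c^', P w) -> (\forall w \near c^', Q w) ->
  \forall w \near c^', S w.
Proof.
move=> PQ /dnbhsCP[r r0 h] /dnbhsCP[s s0 k]; apply/dnbhsCP.
exists (Num.min r s); first by rewrite lt_min r0.
by move=> w wc; rewrite lt_min => /andP[wr ws]; apply: PQ; [|exact: h|exact: k].
Qed.

Lemma nbhs_mono (P Q : set C) c : (forall w, P w -> Q w) ->
  (\forall w \near c, P w) -> \forall w \near c, Q w.
Proof.
move=> PQ /nbhsCP[r r0 h]; apply/nbhsCP; exists r; first exact: r0.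
by move=> w wr; apply: PQ; exact: h.
Qed.

Lemma nbhs_mono2 (P Q S : set C) c : (forall w, P w -> Q w -> S w) ->
  (\forall w \near c, P w) -> (\forall w \near c, Q w) ->
  \forall w \near c, S w.
Proof.
move=> PQ /nbhsCP[r r0 h] /nbhsCP[s s0 k]; apply/nbhsCP.
exists (Num.min r s); first by rewrite lt_min r0.
by move=> w; rewrite lt_min => /andP[wr ws]; apply: PQ; [exact: h|exact: k].
Qed.

Lemma nbhs_all (P : set C) c : (forall w, P w) -> \forall w \near c, P w.
Proof. by move=> h; apply/nbhsCP; exists 1; [exact: ltr01|move=> w _; exact: h]. Qed.

(** An expansion with poles of order at most m is a power series for (w - c)^m
    F w; all operations on Laurent expansions are reduced to power series in
    this form. *)
Definition laurent_at (m : nat) F c a : Prop :=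
  (forall k : int, k < - m%:Z -> a k = 0) /\
  \forall w \near c^',
    psum (fun j : nat => a (j%:Z - m%:Z)) (w - c) ((w - c) ^+ m * F w).

Lemma laurentP F c a : laurent F c a <-> exists m, laurent_at m F c a.
Proof.
split=> -[m [a0 h]]; exists m; (split; first exact: a0);
  apply: dnbhs_mono h => w wc h.
- by apply/psum_exprz; [rewrite subr_eq0|exact: h].
- by apply/(@psum_exprz _ _ _ _ m); [rewrite subr_eq0|exact: h].
Qed.

Lemma laurent_at_near m F G c a :
  (\forall w \near c^', F w = G w) -> laurent_at m F c a -> laurent_at m G c a.
Proof.
move=> fg [a0 h]; split; first exact: a0.
by apply: dnbhs_mono2 fg h => w _ ->.
Qed.

Lemma laurent_near F G c a :
  (\forall w \near c^', F w = G w) -> laurent F c a -> laurent G c a.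
Proof.
by move=> fg /laurentP[m h]; apply/laurentP; exists m; exact: (laurent_at_near fg h).
Qed.

Lemma laurent_at_eq m F c a b : a =1 b -> laurent_at m F c a -> laurent_at m F c b.
Proof. by move=> /funext ->. Qed.

Lemma laurent_at_raise1 m F c a : laurent_at m F c a -> laurent_at m.+1 F c a.
Proof.
move=> [a0 h]; split=> [k km|]; first by apply: a0; lia.
apply: dnbhs_mono h => w _ /psum_mulX; rewrite mulrA -exprS; congr (psum _ _ _).
apply/funext => -[|j]; first by rewrite a0//; lia.
by congr a; lia.
Qed.

Lemma laurent_at_lower1 m F c a :
  laurent_at m.+1 F c a -> a (- m.+1%:Z) = 0 -> laurent_at m F c a.
Proof.
move=> [a0 h] am; split=> [k km|].
  have [->//|ne] := eqVneq k (- m.+1%:Z); apply: a0; lia.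
move/dnbhsCP : h => [r r0 h]; apply/dnbhsCP; exists r; first exact: r0.
move=> w wc wr.
have wc0 : w - c != 0 by rewrite subr_eq0.
have := psum_divX wc0 (h w wc wr).
rewrite [a _](_ : _ = 0) ?subr0; last by rewrite sub0r.
rewrite exprS -mulrA mulKf//; congr (psum _ _ _).
by apply/funext => j; congr a; lia.
Qed.

(** The order m occurring in the definition of [laurent] need not be the
    smallest one; only the vanishing of the coefficients matters. *)
Lemma laurent_at_reindex m m' F c a : laurent_at m F c a ->
  (forall k : int, k < - m'%:Z -> a k = 0) -> laurent_at m' F c a.
Proof.
move=> h; elim: m' => [|m' IH] am'.
  elim: m h => [//|m IH] /laurent_at_lower1 h; apply: IH; apply: h; apply: am'; lia.
have [mm|mm] := leqP m m'.+1.
  clear -mm h; rewrite -(subnKC mm); elim: (m'.+1 - m)%N => [|d IH]; first by rewrite addn0.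
  by rewrite addnS; exact: laurent_at_raise1.
rewrite -(subnKC mm) in h; clear mm IH.
have low n d : (forall k : int, k < - n%:Z -> a k = 0) ->
    laurent_at (n + d) F c a -> laurent_at n F c a.
  move=> an; elim: d => [|d IH]; first by rewrite addn0.
  by rewrite addnS => /laurent_at_lower1 h'; apply: IH; apply: h'; apply: an; lia.
apply: (low _ (m - m'.+2).+1 am').
by rewrite addnS -addSn; exact: h.
Qed.

Lemma laurent_reindex m' F c a : laurent F c a ->
  (forall k : int, k < - m'%:Z -> a k = 0) -> laurent_at m' F c a.
Proof. by move=> /laurentP[m h] h'; exact: (laurent_at_reindex h h'). Qed.

Lemma laurent_atD m F G c a b : laurent_at m F c a -> laurent_at m G c b ->
  laurent_at m (fun w => F w + G w) c (fun k => a k + b k).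
Proof.
move=> [a0 h] [b0 h']; split=> [k km|]; first by rewrite a0// b0// addr0.
by apply: dnbhs_mono2 h h' => w _ /psumD H /H; rewrite -mulrDr.
Qed.

Lemma laurent_atZ m (k : C) F c a : laurent_at m F c a ->
  laurent_at m (fun w => k * F w) c (fun j => k * a j).
Proof.
move=> [a0 h]; split=> [j jm|]; first by rewrite a0// mulr0.
by apply: dnbhs_mono h => w _ /(psumZ (k := k)); rewrite mulrCA.
Qed.

Lemma laurent_at0 m c : laurent_at m (fun=> 0) c (fun=> 0).
Proof.
split; first by [].
apply/dnbhsCP; exists 1; first exact: ltr01.
by move=> w _ _; rewrite mulr0; exact: psum0.
Qed.

Lemma laurent_at_sum (I : Type) (s : seq I) m (F : I -> C -> C) c (a : I -> int -> C) :
  (forall i, laurent_at m (F i) c (a i)) ->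
  laurent_at m (fun w => \sum_(i <- s) F i w) c (fun k => \sum_(i <- s) a i k).
Proof.
move=> h; elim: s => [|i s IH].
  have -> : (fun w => \sum_(i <- [::]) F i w) = fun=> 0.
    by apply/funext => y; rewrite big_nil.
  have -> : (fun w => \sum_(i <- [::]) a i w) = fun=> 0.
    by apply/funext => y; rewrite big_nil.
  exact: (laurent_at0 m c).
have -> : (fun y => \sum_(j <- i :: s) F j y) =
  (fun y => F i y + \sum_(j <- s) F j y) by apply/funext => y; rewrite big_cons.
have -> : (fun y => \sum_(j <- i :: s) a j y) =
  (fun y => a i y + \sum_(j <- s) a j y) by apply/funext => y; rewrite big_cons.
exact: (laurent_atD (h i) IH).
Qed.

(** The coefficient of exponent k in the product of two Laurent series with
    poles of order at most p and q; it is a finite sum because the indices are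
    bounded below. *)
Definition laurent_conv (p q : nat) a b (k : int) : C :=
  if k + (p + q)%:Z is Posz N
  then \sum_(i < N.+1) a (i%:Z - p%:Z) * b ((N - i)%:Z - q%:Z) else 0.

Lemma laurent_atM p q F G c a b : laurent_at p F c a -> laurent_at q G c b ->
  laurent_at (p + q) (fun w => F w * G w) c (laurent_conv p q a b).
Proof.
move=> [a0 h] [b0 h']; split=> [k km|].
  by rewrite /laurent_conv; case E : (k + (p + q)%:Z) => [N|N]//; lia.
have [M [r [hM1 hM2]]] := near_psum_common_bound h h'.
have rp : 0 < r by case: hM1.
move/dnbhsCP : h => [s s0 h]; move/dnbhsCP : h' => [t t0 h'].
apply/dnbhsCP; exists (Num.min (r / 4) (Num.min s t)).
  by rewrite !lt_min s0 t0 !andbT; lra.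
move=> w wc; rewrite !lt_min => /and3P[wr ws wt].
have := psum_mul hM1 hM2 (ltW wr) (h w wc ws) (h' w wc wt).
rewrite mulrACA -exprD; congr (psum _ _ _).
by apply/funext => j; rewrite /laurent_conv subrK.
Qed.

Lemma dnbhs_nbhs (P : set C) c : (\forall w \near c, P w) -> \forall w \near c^', P w.
Proof. by move=> /nbhsCP[r r0 h]; apply/dnbhsCP; exists r => // w _; exact: h. Qed.

Lemma dnbhs_near (P : set C) c :
  (\forall w \near c^', P w) -> \forall w \near c^', \forall v \near w, P v.
Proof.
move=> /dnbhsCP[r r0 h]; apply/dnbhsCP; exists r; first exact: r0.
move=> w wc wr.
apply/nbhsCP; exists (Num.min (cmod (w - c)) (r - cmod (w - c))).
  by rewrite lt_min cmod_gt0 subr_eq0 wc subr_gt0.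
move=> v; rewrite lt_min => /andP[vw vr]; apply: h.
  by apply/eqP => E; move: vw; rewrite E cmodB ltxx.
have := cmodD (v - w) (w - c); rewrite addrA subrK; lra.
Qed.

(** Giving f the value b_0 at the centre makes the singularity removable,
    which reduces the claim to [near_psum_derive]. *)
Lemma near_psum_derive_punctured (b : nat -> C) (f : C -> C) c :
  (\forall w \near c^', psum b (w - c) (f w)) ->
  (\forall w \near c^', derivable f w 1 /\ psum (deriv_coef b) (w - c) (derive1 f w)).
Proof.
move=> h; pose g w := if w == c then b 0%N else f w.
have hg : \forall w \near c, psum b (w - c) (g w).
  move/dnbhsCP : h => [r r0 h]; apply/nbhsCP; exists r; first exact: r0.
move=> w wr.
  rewrite /g; case: eqVneq => [->|wc]; last exact: h.
  by rewrite subrr; exact: psum_at0.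
have gf : \forall w \near c^', g w = f w.
  apply/dnbhsCP; exists 1 => // w wc _; by rewrite /g (negbTE wc).
apply: dnbhs_mono2 (dnbhs_nbhs (near_psum_derive hg)) (dnbhs_near gf).
move=> w _ [h1 h2] h3.
have [h4 h5] := has_deriv_near h3 (derivable_has_deriv h1).
by rewrite h5.
Qed.

(** With u = w - c and G = u^m F, a power series, one has u^(m+1) F' = u G' -
    m G, whose j-th coefficient is (j - m) a_(j-m). *)
Lemma laurent_at_derive m F c a : laurent_at m F c a ->
  (\forall w \near c^', derivable F w 1) /\
  laurent_at m.+1 (derive1 F) c (fun k => (k + 1)%:~R * a (k + 1)).
Proof.
move=> [a0 h].
pose G w := (w - c) ^+ m * F w.
have hG := near_psum_derive_punctured h.
have dF : \forall w \near c^', derivable F w 1.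
  move/dnbhsCP : hG => [r r0 hG]; apply/dnbhsCP; exists r; first exact: r0.
move=> w wc wr.
  have [dG _] := hG w wc wr.
  have dV : derivable (fun v => ((v - c) ^+ m)^-1) w 1.
    apply: derivableV1; first by rewrite expf_neq0// subr_eq0.
    by case: (has_derivX m (has_deriv_shift c w)).
  have [d _] := has_derivM (derivable_has_deriv dV) (derivable_has_deriv dG).
  have E : \forall v \near w, ((v - c) ^+ m)^-1 * ((v - c) ^+ m * F v) = F v.
    have : \forall v \near w, v != c.
      apply/nbhsCP; exists (cmod (w - c)); first by rewrite cmod_gt0 subr_eq0.
      by move=> v vw; apply/eqP => E; move: vw; rewrite E cmodB ltxx.
    by apply: nbhs_mono => v vc; rewrite mulKf// expf_neq0// subr_eq0.
  by have [] := has_deriv_near E (derivable_has_deriv d).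
split; first exact: dF.
split=> [k km|].
  have [->|ne] := eqVneq k (-1); first by rewrite subrr mul0r.
  by rewrite a0 ?mulr0//; lia.
apply: dnbhs_mono2 (dnbhs_mono2 (fun w _ p q => conj p q) dF h) hG.
move=> w _ [d hw] [_ hD].
have e : derive1 (fun w => (w - c) ^+ m * F w) w =
    m%:R * (w - c) ^+ m.-1 * F w + (w - c) ^+ m * derive1 F w.
  have := has_derivM (has_derivX m (has_deriv_shift c w)) (derivable_has_deriv d).
  by move=> /has_derivE ->; rewrite mulr1.
rewrite e in hD.
have := psumD (psum_mulX hD) (psumZ (k := - m%:R) hw).
rewrite [X in psum _ _ X](_ : _ = (w - c) ^+ m.+1 * derive1 F w); last first.
  move: (derive1 F w) (F w) (w - c) => x y u; clear.
  by case: m => [|m]; rewrite ?exprS /=; ring.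
congr (psum _ _ _); apply/funext => j.
have -> : j%:Z - m.+1%:Z + 1 = j%:Z - m%:Z by lia.
case: j => [|j].
  by rewrite add0r sub0r mulrNz -pmulrn.
rewrite /deriv_coef -mulrDl; congr (_ * _).
by rewrite rmorphB /=.
Qed.

(** The sum extends continuously to the centre with value b_0, so b_0 = 0;
    dividing by w - c reduces b_(j+1) to b_j. *)
Lemma psum_eq0 (b : nat -> C) c :
  (\forall w \near c^', psum b (w - c) 0) -> b =1 (fun=> 0).
Proof.
have first (a : nat -> C) : (\forall w \near c^', psum a (w - c) 0) -> a 0%N = 0.
  move=> h; pose g w : C := if w == c then a 0%N else 0.
  have hg : \forall w \near c, psum a (w - c) (g w).
    move/dnbhsCP : h => [r r0 h]; apply/nbhsCP; exists r; first exact: r0.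
move=> w wr.
    rewrite /g; case: eqVneq => [->|wc]; last exact: h.
    by rewrite subrr; exact: psum_at0.
  have gf : \forall w \near c^', g w = 0.
    by apply/dnbhsCP; exists 1 => // w wc _; rewrite /g (negbTE wc).
  have [d _] := nbhs_singleton (near_psum_derive hg).
  by have := eq_of_cst_punctured d gf; rewrite /g eqxx.
move=> h j; elim: j b h => [|j IH] b h; first exact: first.
apply: (IH (fun j => b j.+1)).
have b0 := first b h.
move/dnbhsCP : h => [r r0 h]; apply/dnbhsCP; exists r; first exact: r0.
move=> w wc wr.
have wc0 : w - c != 0 by rewrite subr_eq0.
by have := psum_divX wc0 (h w wc wr); rewrite b0 subrr mulr0.
Qed.

Lemma laurent_unique0 F c a : laurent F c a ->
  (\forall w \near c^', F w = 0) -> forall k, a k = 0.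
Proof.
move=> /laurentP[m [a0 h]] F0 k.
have [km|mk] := ltP k (- m%:Z); first exact: a0.
have hb : \forall w \near c^', psum (fun j : nat => a (j%:Z - m%:Z)) (w - c) 0.
  by apply: dnbhs_mono2 h F0 => w _ + Fw; rewrite Fw mulr0.
have <- := psum_eq0 hb (absz (k + m%:Z)); congr a; lia.
Qed.

Lemma holomorphic_laurent F c : holomorphic F c ->
  exists a, laurent_at 0 F c a.
Proof.
move=> [b h]; exists (fun k => if k is Posz n then b n else 0).
split=> [[n|n]//|]; apply: dnbhs_mono (dnbhs_nbhs h) => w _.
rewrite expr0 mul1r; congr (psum _ _ _).
by apply/funext => j; rewrite subr0.
Qed.

Lemma holomorphic_near F G c :
  (\forall w \near c, F w = G w) -> holomorphic F c -> holomorphic G c.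
Proof.
move=> fg [b h]; exists b; by apply: nbhs_mono2 fg h => w ->.
Qed.

Lemma holomorphic_derivable F c : holomorphic F c -> \forall w \near c, derivable F w 1.
Proof. by move=> [b /near_psum_derive]; apply: nbhs_mono => w []. Qed.

Lemma holomorphic_derive1 F c : holomorphic F c -> holomorphic (derive1 F) c.
Proof.
by move=> [b /near_psum_derive h]; exists (deriv_coef b); apply: nbhs_mono h => w [].
Qed.

Lemma holomorphicD F G c : holomorphic F c -> holomorphic G c ->
  holomorphic (fun w => F w + G w) c.
Proof.
move=> [a ha] [b hb]; exists (fun j => a j + b j).
by apply: nbhs_mono2 ha hb => w /psumD H /H.
Qed.

Lemma holomorphicZ (k : C) F c : holomorphic F c -> holomorphic (fun w => k * F w) c.
Proof.
by move=> [a ha]; exists (fun j => k * a j); apply: nbhs_mono ha => w /(psumZ (k := k)).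
Qed.

Lemma holomorphic0 c : holomorphic (fun=> 0) c.
Proof.
exists (fun=> 0); apply: nbhs_all => w; exact: psum0.
Qed.

Lemma holomorphic_sum (I : Type) (s : seq I) (F : I -> C -> C) c :
  (forall i, holomorphic (F i) c) -> holomorphic (fun w => \sum_(i <- s) F i w) c.
Proof.
move=> h; elim: s => [|i s IH].
  have -> : (fun w => \sum_(i <- [::]) F i w) = fun=> 0.
    by apply/funext => y; rewrite big_nil.
  exact: (holomorphic0 c).
have -> : (fun y => \sum_(j <- i :: s) F j y) =
  (fun y => F i y + \sum_(j <- s) F j y) by apply/funext => y; rewrite big_cons.
exact: (holomorphicD (h i) IH).
Qed.

Lemma holomorphicM F G c : holomorphic F c -> holomorphic G c ->
  holomorphic (fun w => F w * G w) c.
Proof.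
move=> [a h] [b h']; exists (cauchy_product a b).
have [M [r [hM1 hM2]]] := near_psum_common_bound (dnbhs_nbhs h) (dnbhs_nbhs h').
have rp : 0 < r by case: hM1.
move/nbhsCP : h => [s s0 h]; move/nbhsCP : h' => [t t0 h'].
apply/nbhsCP; exists (Num.min (r / 4) (Num.min s t)).
  by rewrite !lt_min s0 t0 !andbT; lra.
move=> w; rewrite !lt_min => /and3P[wr ws wt].
exact: (psum_mul hM1 hM2 (ltW wr) (h w ws) (h' w wt)).
Qed.

End Laurent.

(** * Laurent coefficients of the covariant derivative *)

Section CharacteristicZero.
Variable F : numFieldType.

Lemma eq_opp0 (x : F) : x = - x -> x = 0.
Proof. by move/eqP; rewrite -addr_eq0 -mulr2n mulrn_eq0 => /eqP. Qed.

Lemma double_eq0 (x : F) : (1 + 1) * x = 0 -> x = 0.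
Proof. by rewrite mulrDl mul1r => /eqP; rewrite addr_eq0 => /eqP/eq_opp0. Qed.

End CharacteristicZero.

Section FormalLaurent.
Variables (F : numFieldType) (m : nat).
Local Notation M := 'M[F]_m.
Implicit Types (a w : int -> M) (e : int -> F).

Definition mxbracket (A B : M) : M := A *m B - B *m A.

Lemma mxbracket0r A : mxbracket A 0 = 0.
Proof. by rewrite /mxbracket mulmx0 mul0mx subr0. Qed.

Lemma mxbracket0l A : mxbracket 0 A = 0.
Proof. by rewrite /mxbracket mulmx0 mul0mx subr0. Qed.

(** Coefficient of exponent k in [w, a], for w with a simple pole and a with a
    double pole at most. These bounds cover all the algebras; the coefficient
    a_(-2) vanishes except for sp(2n). *)
Definition bracket_coef w a (k : int) : M :=
  if k + 3 is Posz N
  then \sum_(i < N.+1) mxbracket (w (i%:Z - 1)) (a ((N - i)%:Z - 2)) else 0.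

(** Coefficients of a' + [w, a], with a pole of order at most 3. *)
Definition nabla_coef w a (k : int) : M :=
  (k + 1)%:~R *: a (k + 1) + bracket_coef w a k.

(** Coefficients of e a, for e holomorphic and a with a pole of order at most
    3. *)
Definition scale_coef e a (k : int) : M :=
  if k + 3 is Posz N
  then \sum_(i < N.+1) e i%:Z *: a ((N - i)%:Z - 3) else 0.

Lemma nabla_coefN3 w a : nabla_coef w a (-3) = -2 *: a (-2) + mxbracket (w (-1)) (a (-2)).
Proof.
rewrite /nabla_coef /bracket_coef.
have -> : -3 + 3 = 0 :> int by [].
by rewrite big_ord1.
Qed.

Lemma nabla_coefN2 w a : nabla_coef w a (-2) =
  - a (-1) + (mxbracket (w (-1)) (a (-1)) + mxbracket (w 0) (a (-2))).
Proof.
rewrite /nabla_coef /bracket_coef.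
have -> : -2 + 3 = 1 :> int by [].
rewrite !big_ord_recl big_ord0 addr0; congr (_ + _).
by rewrite -scaleN1r.
Qed.

Lemma nabla_coefN1 w a : nabla_coef w a (-1) =
  mxbracket (w (-1)) (a 0) + mxbracket (w 0) (a (-1)) + mxbracket (w 1) (a (-2)).
Proof.
rewrite /nabla_coef /bracket_coef.
have -> : -1 + 3 = 2 :> int by [].
have -> : -1 + 1 = 0 :> int by [].
by rewrite scale0r add0r !big_ord_recl big_ord0 addr0 addrA.
Qed.

Lemma nabla_coef0 w a : nabla_coef w a 0 =
  a 1 + (mxbracket (w (-1)) (a 1) + mxbracket (w 0) (a 0) + mxbracket (w 1) (a (-1)) +
    mxbracket (w 2) (a (-2))).
Proof.
rewrite /nabla_coef /bracket_coef.
have -> : 0 + 3 = 3 :> int by [].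
by rewrite !big_ord_recl big_ord0 addr0 !addrA add0r scale1r.
Qed.

Lemma nabla_coef1 w a : nabla_coef w a 1 =
  2 *: a 2 + (mxbracket (w (-1)) (a 2) + mxbracket (w 0) (a 1) + mxbracket (w 1) (a 0) +
    mxbracket (w 2) (a (-1)) + mxbracket (w 3) (a (-2))).
Proof.
rewrite /nabla_coef /bracket_coef.
have -> : 1 + 3 = 4 :> int by [].
by rewrite !big_ord_recl big_ord0 addr0 !addrA.
Qed.

Lemma scale_coefN3 e a : scale_coef e a (-3) = e 0 *: a (-3).
Proof.
rewrite /scale_coef; have -> : -3 + 3 = 0 :> int by [].
by rewrite big_ord1.
Qed.

Lemma scale_coefN2 e a : scale_coef e a (-2) = e 0 *: a (-2) + e 1 *: a (-3).
Proof.
rewrite /scale_coef; have -> : -2 + 3 = 1 :> int by [].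
by rewrite !big_ord_recl big_ord0 addr0.
Qed.

Lemma scale_coefN1 e a : scale_coef e a (-1) =
  e 0 *: a (-1) + e 1 *: a (-2) + e 2 *: a (-3).
Proof.
rewrite /scale_coef; have -> : -1 + 3 = 2 :> int by [].
by rewrite !big_ord_recl big_ord0 addr0 addrA.
Qed.

Lemma scale_coef0 e a : scale_coef e a 0 =
  e 0 *: a 0 + e 1 *: a (-1) + e 2 *: a (-2) + e 3 *: a (-3).
Proof.
rewrite /scale_coef; have -> : 0 + 3 = 3 :> int by [].
by rewrite !big_ord_recl big_ord0 addr0 !addrA.
Qed.

Lemma scale_coef1 e a : scale_coef e a 1 =
  e 0 *: a 1 + e 1 *: a 0 + e 2 *: a (-1) + e 3 *: a (-2) + e 4 *: a (-3).
Proof.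
rewrite /scale_coef; have -> : 1 + 3 = 4 :> int by [].
by rewrite !big_ord_recl big_ord0 addr0 !addrA.
Qed.

Lemma scale_coef_pole e a k : k < -3 -> scale_coef e a k = 0.
Proof. by rewrite /scale_coef => k3; case E : (k + 3) => [N|N]//; lia. Qed.

Lemma nabla_coef_pole w a k : (forall j : int, j < -2 -> a j = 0) -> k < -3 ->
  nabla_coef w a k = 0.
Proof.
move=> a0 k3; rewrite /nabla_coef a0 ?scaler0 ?add0r; last by lia.
by rewrite /bracket_coef; case E : (k + 3) => [N|N]//; lia.
Qed.

Section Gl.
Implicit Types (u v x y : 'cV[F]_m) (A : M).

Definition dotp u v : F := (u^T *m v) 0 0.
(** Locked so that associativity of the product of matrices does not break up
    the rank one factors. *)
Definition rank1 u v : M := locked (u *m v^T).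

Lemma rank1E u v : rank1 u v = u *m v^T. Proof. by rewrite /rank1 -lock. Qed.

Lemma dotpE u v : u^T *m v = (dotp u v)%:M. Proof. exact: mx11_scalar. Qed.
Lemma dotpDl u v x : dotp (u + v) x = dotp u x + dotp v x.
Proof. by rewrite /dotp linearD mulmxDl mxE. Qed.
Lemma dotpNl u x : dotp (- u) x = - dotp u x.
Proof. by rewrite /dotp linearN mulNmx mxE. Qed.
Lemma dotpZl k u x : dotp (k *: u) x = k * dotp u x.
Proof. by rewrite /dotp linearZ -scalemxAl mxE. Qed.
Lemma dotpZr k u x : dotp u (k *: x) = k * dotp u x.
Proof. by rewrite /dotp -scalemxAr mxE. Qed.
Lemma dotp_tr A u x : dotp (A^T *m u) x = dotp u (A *m x).
Proof. by rewrite /dotp trmx_mul trmxK mulmxA. Qed.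

Lemma rank1_0l v : rank1 0 v = 0. Proof. by rewrite !rank1E mul0mx. Qed.
Lemma dotp0r v : dotp v 0 = 0. Proof. by rewrite /dotp mulmx0 mxE. Qed.
Lemma rank1_col u v x : rank1 u v *m x = dotp v x *: u.
Proof. by rewrite !rank1E -mulmxA dotpE mul_mx_scalar. Qed.
Lemma rank1M u v x y : rank1 u v *m rank1 x y = dotp v x *: rank1 u y.
Proof. by rewrite (rank1E x y) mulmxA rank1_col -scalemxAl rank1E. Qed.
Lemma mulmx_rank1 A u v : A *m rank1 u v = rank1 (A *m u) v.
Proof. by rewrite !rank1E mulmxA. Qed.
Lemma rank1_mulmx A u v : rank1 u v *m A = rank1 u (A^T *m v).
Proof. by rewrite !rank1E trmx_mul trmxK mulmxA. Qed.
Lemma rank1Zl k u v : rank1 (k *: u) v = k *: rank1 u v.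
Proof. by rewrite !rank1E -scalemxAl. Qed.
Lemma rank1Zr k u v : rank1 u (k *: v) = k *: rank1 u v.
Proof. by rewrite !rank1E linearZ -scalemxAr. Qed.
Lemma rank1Dr u v x : rank1 u (v + x) = rank1 u v + rank1 u x.
Proof. by rewrite !rank1E linearD mulmxDr. Qed.
Lemma rank1Nr u v : rank1 u (- v) = - rank1 u v.
Proof. by rewrite !rank1E linearN mulmxN. Qed.

Definition gl_lax (alpha : 'cV[F]_m) a : Prop :=
  (forall k : int, k < -1 -> a k = 0) /\
  exists beta kappa, [/\ a (-1) = rank1 alpha beta, dotp beta alpha = 0 &
    a 0 *m alpha = kappa *: alpha].

(** The guard on alpha merges the two cases of a connection form: for
    alpha = 0 the residue vanishes and the eigenvector condition is void. *)
Definition gl_connection (alpha : 'cV[F]_m) w : Prop :=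
  exists beta kappa, [/\ w (-1) = rank1 alpha beta, (alpha != 0 -> dotp beta alpha = 1) &
    w 0 *m alpha = kappa *: alpha].

(** Write t for the vector of the residue of omega. In degree -2 the
    derivative contributes -alpha beta^T and the bracket of the residues (t^T
    alpha) alpha beta^T, which cancel. In degree -1 all terms have the form
    alpha x^T. In degree 0 the term a_1 alpha of the derivative cancels
    against a_1 w_(-1) alpha, and the other terms are multiples of alpha. *)
Lemma gl_lax_nabla alpha a w : gl_lax alpha a -> gl_connection alpha w ->
  gl_lax alpha (nabla_coef w a).
Proof.
move=> [a0 [b [k [ea1 ba ea0]]]] [t [l [ew1 ta ew0]]].
have aN2 : a (-2) = 0 by apply: a0.
have pole j : j < -2 -> a j = 0 by move=> h; apply: a0; lia.
have [al0|alN0] := eqVneq alpha 0.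
  have ea1' : a (-1) = 0 by rewrite ea1 al0 rank1_0l.
  have ew1' : w (-1) = 0 by rewrite ew1 al0 rank1_0l.
  split=> [j j1|].
    have [-> |j2] := eqVneq j (-2).
      by rewrite nabla_coefN2 ea1' aN2 !mxbracket0r oppr0 !addr0.
    have [-> |j3] := eqVneq j (-3).
      by rewrite nabla_coefN3 aN2 mxbracket0r scaler0 addr0.
    by rewrite nabla_coef_pole//; lia.
  exists 0, 0; split.
  - by rewrite nabla_coefN1 ew1' ea1' aN2 !mxbracket0r mxbracket0l !addr0 al0 rank1_0l.
  - by rewrite al0 dotp0r.
  - by rewrite al0 mulmx0 scaler0.
have {}ta := ta alN0.
split=> [j j1|].
  have [-> |j2] := eqVneq j (-2).
    rewrite nabla_coefN2 aN2 ew1 ea1 /mxbracket !rank1M mulmx0 mul0mx ta ba.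
    by rewrite scale0r scale1r !subr0 addr0 addNr.
  have [-> |j3] := eqVneq j (-3).
    by rewrite nabla_coefN3 aN2 /mxbracket mulmx0 mul0mx scaler0 subr0 addr0.
  by rewrite nabla_coef_pole//; lia.
(* Collecting the terms of degree -1 as alpha times a row gives this beta. *)
exists ((a 0)^T *m t + - (k *: t) + l *: b + - ((w 0)^T *m b)).
exists (dotp t (a 1 *m alpha) - dotp b (w 1 *m alpha)); split.
- rewrite nabla_coefN1 aN2 ew1 ea1 /mxbracket mulmx0 mul0mx subr0 addr0.
  rewrite !(rank1_mulmx, mulmx_rank1) ea0 ew0 !(rank1Dr, rank1Nr, rank1Zl, rank1Zr).
  by rewrite !addrA.
- rewrite !(dotpDl, dotpNl, dotpZl, dotp_tr) ea0 ew0 !dotpZr ta ba; ring.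
- rewrite nabla_coef0 aN2 ew1 ea1 /mxbracket mulmx0 mul0mx subr0 addr0.
  rewrite !(mulmxDl, mulNmx).
  rewrite -!mulmxA !rank1_col ea0 ew0 -!scalemxAr.
  rewrite ea0 ew0 ta ba.
  apply/matrixP => i j; rewrite !mxE; ring.
Qed.

Lemma gl_lax_scale alpha e a : gl_lax alpha a -> gl_lax alpha (scale_coef e a).
Proof.
move=> [a0 [b [k [ea1 ba ea0]]]].
have aN2 : a (-2) = 0 by apply: a0.
have aN3 : a (-3) = 0 by apply: a0.
split=> [j j1|].
  have [-> |j2] := eqVneq j (-2).
    by rewrite scale_coefN2 aN2 aN3 !scaler0 addr0.
  have [-> |j3] := eqVneq j (-3).
    by rewrite scale_coefN3 aN3 scaler0.
  by rewrite scale_coef_pole//; lia.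
exists (e 0 *: b), (e 0 * k); split.
- by rewrite scale_coefN1 aN2 aN3 !scaler0 !addr0 ea1 rank1Zr.
- by rewrite dotpZl ba mulr0.
- rewrite scale_coef0 aN2 aN3 !scaler0 !addr0 mulmxDl -!scalemxAl ea0 ea1 rank1_col ba.
  by rewrite scale0r scaler0 addr0 scalerA.
Qed.
End Gl.

Section Metric.
Variables (eps : F) (sigma : M).
Hypothesis eps1 : eps = 1 \/ eps = -1.
Hypothesis sigma_tr : sigma^T = eps *: sigma.
Implicit Types (u v x y : 'cV[F]_m) (A : M).

Definition form u v : F := (u^T *m sigma *m v) 0 0.
(** The rank one matrix u v^T sigma, which maps x to (v, x) u for the form
    sigma. *)
Definition ketbra u v : M := locked (u *m v^T *m sigma).

Lemma ketbraE u v : ketbra u v = u *m v^T *m sigma. Proof. by rewrite /ketbra -lock. Qed.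
Definition skew_adjoint A : Prop := A^T *m sigma + sigma *m A = 0.

Lemma formE u v : u^T *m sigma *m v = (form u v)%:M.
Proof. exact: mx11_scalar. Qed.
Lemma form_sym u v : form u v = eps * form v u.
Proof.
rewrite /form -[u^T *m sigma *m v]trmxK [in LHS]mxE !trmx_mul trmxK sigma_tr.
by rewrite -scalemxAl -scalemxAr mxE -mulmxA.
Qed.
Lemma formDl u v x : form (u + v) x = form u x + form v x.
Proof. by rewrite /form linearD !mulmxDl mxE. Qed.
Lemma formNl u x : form (- u) x = - form u x.
Proof. by rewrite /form linearN !mulNmx mxE. Qed.
Lemma formZl k u x : form (k *: u) x = k * form u x.
Proof. by rewrite /form linearZ -!scalemxAl mxE. Qed.
Lemma formDr u v x : form x (u + v) = form x u + form x v.
Proof. by rewrite /form !mulmxDr mxE. Qed.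
Lemma formNr u x : form x (- u) = - form x u.
Proof. by rewrite /form !mulmxN mxE. Qed.
Lemma formZr k u x : form u (k *: x) = k * form u x.
Proof. by rewrite /form -scalemxAr mxE. Qed.
Lemma skew_adjointE A : skew_adjoint A -> A^T *m sigma = - (sigma *m A).
Proof. by move/eqP; rewrite addr_eq0 => /eqP. Qed.
Lemma form_adj A u x : skew_adjoint A -> form (A *m u) x = - form u (A *m x).
Proof.
move=> /skew_adjointE h; rewrite /form trmx_mul -[u^T *m A^T *m sigma]mulmxA h.
by rewrite mulmxN mulNmx mxE !mulmxA.
Qed.

Lemma ketbra0l u : ketbra 0 u = 0. Proof. by rewrite !ketbraE !mul0mx. Qed.
Lemma ketbra0r u : ketbra u 0 = 0. Proof. by rewrite !ketbraE trmx0 mulmx0 mul0mx. Qed.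
Lemma form0r u : form u 0 = 0. Proof. by rewrite /form mulmx0 mxE. Qed.
Lemma ketbra_col u v x : ketbra u v *m x = form v x *: u.
Proof. by rewrite !ketbraE -!mulmxA [v^T *m _]mulmxA formE mul_mx_scalar. Qed.
Lemma ketbraM u v x y : ketbra u v *m ketbra x y = form v x *: ketbra u y.
Proof. by rewrite (ketbraE x y) !mulmxA ketbra_col -!scalemxAl ketbraE. Qed.
Lemma mulmx_ketbra A u v : A *m ketbra u v = ketbra (A *m u) v.
Proof. by rewrite !ketbraE !mulmxA. Qed.
Lemma ketbra_mulmx A u v : skew_adjoint A -> ketbra u v *m A = - ketbra u (A *m v).
Proof.
move=> /skew_adjointE h; rewrite !ketbraE trmx_mul -!mulmxA h !mulmxN opprK.
by rewrite !mulmxA.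
Qed.
Lemma ketbraZl k u v : ketbra (k *: u) v = k *: ketbra u v.
Proof. by rewrite !ketbraE -!scalemxAl. Qed.
Lemma ketbraZr k u v : ketbra u (k *: v) = k *: ketbra u v.
Proof. by rewrite !ketbraE linearZ -scalemxAr -scalemxAl. Qed.
Lemma ketbraDr u v x : ketbra u (v + x) = ketbra u v + ketbra u x.
Proof. by rewrite !ketbraE linearD mulmxDr mulmxDl. Qed.
Lemma ketbraNr u v : ketbra u (- v) = - ketbra u v.
Proof. by rewrite !ketbraE linearN mulmxN mulNmx. Qed.
Lemma ketbraDl u v x : ketbra (v + x) u = ketbra v u + ketbra x u.
Proof. by rewrite !ketbraE !mulmxDl. Qed.
Lemma ketbraNl u v : ketbra (- v) u = - ketbra v u.
Proof. by rewrite !ketbraE !mulNmx. Qed.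

(** With eps = -1 these are the conditions for sp(2n). With eps = 1 the
    condition on nu forces nu = 0, the condition on a_1 follows from the
    skewness of a_1, and the remaining ones are those for so(n). *)
Definition metric_lax (alpha : 'cV[F]_m) a : Prop :=
  (forall k : int, k < -2 -> a k = 0) /\
  exists beta nu kappa, [/\ a (-2) = nu *: ketbra alpha alpha /\ (1 + eps) * nu = 0,
    a (-1) = ketbra alpha beta - eps *: ketbra beta alpha, form beta alpha = 0,
    a 0 *m alpha = kappa *: alpha & form alpha (a 1 *m alpha) = 0].

Definition metric_connection (alpha : 'cV[F]_m) w : Prop :=
  exists beta kappa, [/\ w (-1) = ketbra alpha beta - eps *: ketbra beta alpha,
    (alpha != 0 -> form beta alpha = 1),
    w 0 *m alpha = kappa *: alpha & form alpha (w 1 *m alpha) = 0].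

(** Write t for the vector of the residue of omega. In degree -3 the
    derivative contributes -2 nu and the bracket 2 nu times alpha alpha^T
    sigma. Degrees -2 and 0 are as for gl(n), up to multiples of alpha alpha^T
    sigma and of alpha; skew-adjointness of the coefficients makes the residue
    have the required symmetric shape. In degree 1 the pairing with alpha on
    both sides turns 2 a_2 + [w_(-1), a_2] into 2 - 1 - 1 = 0 times (alpha,
    a_2 alpha), and kills every other term. *)
Lemma metric_lax_nabla alpha a w : form alpha alpha = 0 ->
  (forall k, skew_adjoint (a k)) -> (forall k, skew_adjoint (w k)) ->
  metric_lax alpha a -> metric_connection alpha w ->
  metric_lax alpha (nabla_coef w a).
Proof.
move=> aa La Lw [a0 [b [nu [k [[ea2 nu0] ea1 ba ea0 aa1]]]]] [t [l [ew1 ta ew0 aw1]]].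
have [al0|alN0] := eqVneq alpha 0.
  have ea2' : a (-2) = 0 by rewrite ea2 al0 ketbra0l scaler0.
  have ea1' : a (-1) = 0 by rewrite ea1 al0 ketbra0l ketbra0r scaler0 subr0.
  have ew1' : w (-1) = 0 by rewrite ew1 al0 ketbra0l ketbra0r scaler0 subr0.
  split=> [j j1|].
    have [-> |j3] := eqVneq j (-3).
      by rewrite nabla_coefN3 ea2' mxbracket0r scaler0 addr0.
    by rewrite nabla_coef_pole//; lia.
  exists 0, 0, 0; rewrite al0 !ketbra0l !mulmx0 !form0r !scaler0 mulr0 subr0; split=> //.
  - by rewrite nabla_coefN2 ea1' ea2' !mxbracket0r oppr0 !addr0.
  - by rewrite nabla_coefN1 ew1' ea1' ea2' !mxbracket0r mxbracket0l !addr0.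
have {}ta := ta alN0.
have at_ : form alpha t = eps by rewrite form_sym ta mulr1.
have ab : form alpha b = 0 by rewrite form_sym ba mulr0.
have bt := form_sym b t.
split=> [j j1|].
  have [-> |j3] := eqVneq j (-3).
    rewrite nabla_coefN3 /mxbracket ew1 ea2.
    rewrite !(mulmxDl, mulmxDr, mulmxN, mulNmx) -!(scalemxAl, scalemxAr).
    rewrite !ketbraM aa ta at_.
    apply/matrixP => i c; rewrite !mxE; case: eps1 => ->; ring.
  by rewrite nabla_coef_pole//; lia.
(* The three witnesses are read off from the coefficients of degree -1, -2
   and 0. *)
exists (- (a 0 *m t) - k *: t + l *: b + w 0 *m b + nu *: (w 1 *m alpha)).
exists (eps * (form b t - form t b) + 2 * nu * l).
exists (form t (a 1 *m alpha) - form b (w 1 *m alpha) - nu * form alpha (w 2 *m alpha)).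
have nuE : eps * nu = - nu.
  by apply/eqP; rewrite -addr_eq0 addrC -[X in X + _]mul1r -mulrDl nu0.
split.
- split.
    rewrite nabla_coefN2 /mxbracket ew1 ea2 ea1.
    rewrite !(mulmxDl, mulmxDr, mulmxN, mulNmx) -!(scalemxAl, scalemxAr).
    rewrite !(ketbraM, mulmx_ketbra, ketbra_mulmx _ _ (Lw 0)) ew0.
    rewrite !(ketbraZl, ketbraZr) aa ta at_ ab ba.
    by apply/matrixP => i c; rewrite !mxE; case: eps1 => ->; ring.
  rewrite bt; case: eps1 nu0 => -> nu0; last by ring.
  by transitivity (2 * l * ((1 + 1) * nu)); [ring|rewrite nu0 mulr0].
- rewrite nabla_coefN1 /mxbracket ew1 ea2 ea1.
  rewrite !(mulmxDl, mulmxDr, mulmxN, mulNmx) -!(scalemxAl, scalemxAr).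
  rewrite !(mulmx_ketbra, ketbra_mulmx _ _ (Lw _), ketbra_mulmx _ _ (La _)) ew0 ea0.
  rewrite !(ketbraDl, ketbraNl, ketbraDr, ketbraNr, ketbraZl, ketbraZr).
  have nuS (X : M) : eps *: (nu *: X) = - (nu *: X) by rewrite scalerA nuE scaleNr.
  rewrite !scalerDr nuS.
  by apply/matrixP => i c; rewrite !mxE; case: eps1 => ->; ring.
- rewrite !(formDl, formNl, formZl) !form_adj// ea0 ew0 !(formZr, aa1, aw1) ta ba; ring.
- rewrite nabla_coef0 /mxbracket ew1 ea2 ea1 !(mulmxDl, mulNmx) -!mulmxA ea0 ew0.
  rewrite !(mulmxDl, mulmxDr, mulNmx, mulmxN) -!(scalemxAl, scalemxAr) !ketbra_col.
  rewrite ea0 ew0 aa1 aw1 aa ta ba !(scale0r, scaler0, mulmx0) -!scalemxAr.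
  by apply/matrixP => i c; rewrite !mxE; ring.
- rewrite nabla_coef1 /mxbracket ew1 ea2 ea1 !(mulmxDl, mulNmx) -!mulmxA ea0 ew0.
  rewrite !(mulmxDl, mulmxDr, mulNmx, mulmxN) -!(scalemxAl, scalemxAr) !ketbra_col.
  have fw0 x : form alpha (w 0 *m x) = - (l * form alpha x).
    by rewrite -[LHS]opprK -(form_adj _ _ (Lw 0)) ew0 formZl.
  have fa0 x : form alpha (a 0 *m x) = - (k * form alpha x).
    by rewrite -[LHS]opprK -(form_adj _ _ (La 0)) ea0 formZl.
  rewrite !(formDr, formNr, formZr) fw0 fa0 aa ta ba.
  rewrite !(scale0r, scale1r, mulmx0) !form0r aa1 aw1 at_ ab.
  by case: eps1 => ->; ring.
Qed.

(** The term e_1 a_(-2) of the residue is absorbed by adding (e_1 nu / 2)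
    alpha to beta. *)
Lemma metric_lax_scale alpha e a : form alpha alpha = 0 -> a (-3) = 0 ->
  metric_lax alpha a -> metric_lax alpha (scale_coef e a).
Proof.
move=> aa aN3 [a0 [b [nu [k [[ea2 nu0] ea1 ba ea0 aa1]]]]].
have nuE : eps * nu = - nu.
  by apply/eqP; rewrite -addr_eq0 addrC -[X in X + _]mul1r -mulrDl nu0.
split=> [j j1|].
  have [-> |j3] := eqVneq j (-3); first by rewrite scale_coefN3 aN3 scaler0.
  by rewrite scale_coef_pole//; lia.
exists (e 0 *: b + (e 1 * nu / 2) *: alpha), (e 0 * nu), (e 0 * k).
split.
- rewrite scale_coefN2 aN3 scaler0 addr0 ea2 scalerA; split=> //.
  by rewrite mulrCA nu0 mulr0.
- rewrite scale_coefN1 aN3 scaler0 addr0 ea1 ea2.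
  rewrite !(ketbraDr, ketbraDl, ketbraZl, ketbraZr).
  apply/matrixP => i c; rewrite !mxE.
  have h2 : (2 : F) != 0 by rewrite pnatr_eq0.
  have -> : eps * (e 0 * ketbra b alpha i c + e 1 * nu / 2 * ketbra alpha alpha i c) =
    eps * e 0 * ketbra b alpha i c + (eps * nu) * (e 1 / 2 * ketbra alpha alpha i c) by ring.
  by rewrite nuE; field.
- by rewrite formDl !formZl ba aa; ring.
- rewrite scale_coef0 aN3 scaler0 addr0 ea1 ea2 !mulmxDl -!scalemxAl.
  rewrite ea0 !mulmxDl !mulNmx -!scalemxAl !ketbra_col ba aa.
  by rewrite !(scale0r, scaler0, subr0, addr0) scalerA.
- rewrite scale_coef1 aN3 scaler0 addr0 ea1 ea2 !mulmxDl -!scalemxAl.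
  rewrite ea0 !mulmxDl !mulNmx -!scalemxAl !ketbra_col ba aa.
  by rewrite !(scale0r, scaler0, subr0, addr0) !(formDr, formZr) aa aa1; ring.
Qed.

End Metric.
End FormalLaurent.

Section LaxExpansion.
Variables (R : realType) (n : nat).
Local Notation C := (CC R).

Lemma gl_laxP m (alpha : 'cV[C]_m) (a : int -> 'M[C]_m) :
  lax_gl alpha a <-> gl_lax alpha a.
Proof.
split=> -[a0 [b [k [h1 h2 h3]]]]; (split; first exact: a0); exists b, k;
  split=> //.
- by rewrite rank1E.
- by rewrite /dotp h2 mxE.
- by rewrite -rank1E.
- by rewrite dotpE h2 raddf0.
Qed.

Lemma gl_connectionP m (alpha : 'cV[C]_m) (w : int -> 'M[C]_m) :
  (alpha = 0 -> pole_order_le 0 w) ->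
  (alpha <> 0 -> pole_order_le 1 w /\ connection_gl alpha w) ->
  gl_connection alpha w.
Proof.
have [-> /(_ erefl) w0 _|/eqP al _ /(_ al)[_ [b [k [h1 h2 h3]]]]] := eqVneq alpha 0.
  exists 0, 0; split; [by rewrite rank1_0l w0|by rewrite eqxx|by rewrite mulmx0 scaler0].
exists b, k; split=> //; first by rewrite rank1E.
by rewrite /dotp h3 mxE.
Qed.

Lemma metric_connection0 m eps sigma (alpha : 'cV[C]_m) (w : int -> 'M[C]_m) :
  alpha = 0 -> pole_order_le 0 w -> metric_connection eps sigma alpha w.
Proof.
move=> -> w0; exists 0, 0; split; rewrite ?eqxx ?mulmx0 ?scaler0 ?form0r ?ketbra0l //.
by rewrite scaler0 subr0 w0.
Qed.

(** The local part of the theorem: nabla_e preserves the expansion condition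
    at a point gamma_s. *)
Lemma lax_expansion_stable (G : matrix_lie R n) (alpha : 'cV[C]_(mdim G))
    (a w : int -> 'M[C]_(mdim G)) (e : int -> C) :
  well_formed G -> tyurin_vector alpha ->
  (forall k, lie_mem (a k)) -> (forall k, connection_mem (w k)) ->
  lax_expansion alpha a -> connection_expansion alpha w ->
  lax_expansion alpha (scale_coef e (nabla_coef w a)).
Proof.
case: G alpha a w => [||| sigma|] /= alpha a w hG htyu La Lw ha [hw0 hw1].
- by apply/gl_laxP/gl_lax_scale/gl_lax_nabla; [exact/gl_laxP|exact: gl_connectionP].
- by apply/gl_laxP/gl_lax_scale/gl_lax_nabla; [exact/gl_laxP|exact: gl_connectionP].
- pose s : 'M[C]_n := 1%:M.
  have s1 : s^T = 1 *: s by rewrite /s trmx1 scale1r.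
  have fE u v : form s u v = (u^T *m v) 0 0 by rewrite /form /s mulmx1.
  have kE u v : ketbra s u v = u *m v^T by rewrite ketbraE /s mulmx1.
  have liE (A : 'M[C]_n) : A^T = - A -> skew_adjoint s A.
    by move=> h; rewrite /skew_adjoint /s mulmx1 mul1mx h addNr.
  have LA k := liE _ (La k); have LW k := liE _ (Lw k).
  have self A : skew_adjoint s A -> form s alpha (A *m alpha) = 0.
    move=> h; apply: eq_opp0; rewrite {1}(form_sym s1) mul1r; exact: form_adj.
  have aa : form s alpha alpha = 0 by rewrite fE htyu mxE.
  have hm : metric_lax 1 s alpha a.
    case: ha => a0 [b [k [h1 h2 h3]]].
    split=> [j j2|]; first by apply: a0; lia.
    exists b, 0, k; split.
    + by split; [rewrite scale0r a0|rewrite mulr0].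
    + by rewrite scale1r !kE h1.
    + by rewrite fE h2 mxE.
    + exact: h3.
    + by rewrite self.
  have hc : metric_connection 1 s alpha w.
    have [/eqP al|/eqP al] := boolP (alpha == 0).
      by apply: metric_connection0 => //; exact: hw0.
    have [_ [b [k [h1 h2 h3]]]] := hw1 al.
    exists b, k; split.
    + by rewrite scale1r !kE h2.
    + by rewrite fE h3 mxE.
    + exact: h1.
    + by rewrite self.
  have hn := metric_lax_nabla (or_introl erefl) s1 aa LA LW hm hc.
  have aN3 : nabla_coef w a (-3) = 0 by case: hn => + _; apply.
  have [b0 [b [nu [k [[h1 h1'] h2 h3 h4 _]]]]] := metric_lax_scale e aa aN3 hn.
  have nu0 := double_eq0 h1'.
  split=> [j j1|].
    have [-> |j2] := eqVneq j (-2); first by rewrite h1 nu0 scale0r.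
    by apply: b0; lia.
  exists b, k; split; [by rewrite h2 scale1r !kE| |exact: h4].
  by rewrite dotpE /dotp -fE h3 raddf0.
- case: hG => sT sU.
  have s1 : sigma^T = -1 *: sigma by rewrite scaleN1r.
  have aa : form sigma alpha alpha = 0.
    by apply: eq_opp0; rewrite {1}(form_sym s1) mulN1r.
  have hm : metric_lax (-1) sigma alpha a.
    case: ha => a0 [b [nu [k [h1 h2 h3 h4 h5]]]].
    split; first exact: a0.
    exists b, nu, k; split.
    + by split; [rewrite ketbraE h1|rewrite addrN mul0r].
    + by rewrite scaleN1r opprK !ketbraE h2 mulmxDl.
    + by rewrite /form h3 mxE.
    + exact: h4.
    + by rewrite /form mulmxA h5 mxE.
  have hc : metric_connection (-1) sigma alpha w.
    have [/eqP al|/eqP al] := boolP (alpha == 0).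
      by apply: metric_connection0 => //; exact: hw0.
    have [_ [b [k [h1 h2 h3 h4]]]] := hw1 al.
    exists b, k; split.
    + by rewrite scaleN1r opprK !ketbraE h2 mulmxDl.
    + by rewrite /form h3 mxE.
    + exact: h1.
    + by rewrite /form mulmxA h4 mxE.
  have hn := metric_lax_nabla (or_intror erefl) s1 aa La Lw hm hc.
  have aN3 : nabla_coef w a (-3) = 0 by case: hn => + _; apply.
  have [b0 [b [nu [k [[h1 _] h2 h3 h4 h5]]]]] := metric_lax_scale e aa aN3 hn.
  split; first exact: b0.
  exists b, nu, k; split; last 2 first.
  + exact: h4.
  + by rewrite -mulmxA formE h5 raddf0.
  + by rewrite h1 ketbraE.
  + by rewrite h2 scaleN1r opprK !ketbraE mulmxDl.
  + by rewrite formE h3 raddf0.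
- have br0 k : bracket_coef w a k = 0.
    rewrite /bracket_coef; case: (k + 3) => // N; rewrite big1// => i _.
    have /is_scalar_mxP[c ->] := La ((N - i)%:Z - 2).
    by rewrite /mxbracket scalar_mxC subrr.
  move=> k; rewrite oppr0 => k0.
  rewrite /scale_coef; case E : (k + 3) => [N|//]; rewrite big1// => i _.
  rewrite /nabla_coef br0 addr0.
  have [/eqP h|h] := boolP ((N - i)%:Z - 3 == -1); first by rewrite h addNr scale0r scaler0.
  rewrite (ha _) ?scaler0// oppr0; have := ltn_ord i; lia.
Qed.

End LaxExpansion.

(** * The covariant derivative in a coordinate *)

Section Meromorphic.
Variable R : realType.
Local Notation C := (CC R).
Implicit Types (F G : C -> C) (c : C).

Lemma laurent_at_le m m' F c a : (m <= m')%N -> laurent_at m F c a -> laurent_at m' F c a.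
Proof.
move=> mm h; apply: (laurent_at_reindex h) => k km; case: h => + _; apply; lia.
Qed.

Lemma meromorphicP F c : meromorphic F c <-> exists m a, laurent_at m F c a.
Proof.
split=> [[a /laurentP[m h]]|[m [a h]]]; first by exists m, a; exact: h.
by exists a; apply/laurentP; exists m; exact: h.
Qed.

Lemma meromorphic_near F G c :
  (\forall w \near c^', F w = G w) -> meromorphic F c -> meromorphic G c.
Proof. by move=> fg [a h]; exists a; exact: (laurent_near fg h). Qed.

Lemma meromorphicD F G c : meromorphic F c -> meromorphic G c ->
  meromorphic (fun w => F w + G w) c.
Proof.
move=> /meromorphicP[m [a h]] /meromorphicP[m' [a' h']]; apply/meromorphicP.
exists (maxn m m'), (fun k => a k + a' k).
exact: (laurent_atD (laurent_at_le (leq_maxl _ _) h) (laurent_at_le (leq_maxr _ _) h')).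
Qed.

Lemma meromorphicM F G c : meromorphic F c -> meromorphic G c ->
  meromorphic (fun w => F w * G w) c.
Proof.
move=> /meromorphicP[m [a h]] /meromorphicP[m' [a' h']]; apply/meromorphicP.
by exists (m + m')%N, (laurent_conv m m' a a'); exact: (laurent_atM h h').
Qed.

Lemma meromorphicZ (k : C) F c : meromorphic F c -> meromorphic (fun w => k * F w) c.
Proof.
move=> /meromorphicP[m [a h]]; apply/meromorphicP.
by exists m, (fun j => k * a j); exact: (laurent_atZ k h).
Qed.

Lemma meromorphic_derive1 F c : meromorphic F c -> meromorphic (derive1 F) c.
Proof.
move=> /meromorphicP[m [a h]]; apply/meromorphicP.
exists m.+1, (fun k => (k + 1)%:~R * a (k + 1)).
by case: (laurent_at_derive h).
Qed.

Lemma meromorphic_sum (I : Type) (s : seq I) (F : I -> C -> C) c :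
  (forall i, meromorphic (F i) c) -> meromorphic (fun w => \sum_(i <- s) F i w) c.
Proof.
move=> h; elim: s => [|i s IH].
  have -> : (fun w => \sum_(i <- [::]) F i w) = fun=> 0.
    by apply/funext => y; rewrite big_nil.
  apply/meromorphicP; exists 0%N, (fun=> 0); exact: (laurent_at0 0 c).
have -> : (fun y => \sum_(j <- i :: s) F j y) =
  (fun y => F i y + \sum_(j <- s) F j y) by apply/funext => y; rewrite big_cons.
exact: (meromorphicD (h i) IH).
Qed.

End Meromorphic.

Section LocalNabla.
Variables (R : realType) (n : nat).
Local Notation C := (CC R).
Local Notation M := 'M[C]_n.
Implicit Types (E : C -> C) (L Om : C -> M) (c : C).

(** The subtraction is written as addition of a multiple by -1, so that the
    rules for sums and products suffice. *)
Definition bracket_entry Om L (i j : 'I_n) (w : C) : C :=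
  \sum_(k <- index_enum 'I_n) (Om w i k * L w k j + (- 1) * (Om w k j * L w i k)).

Definition nabla_entry E Om L (i j : 'I_n) (w : C) : C :=
  E w * (derive1 (fun v => L v i j) w + bracket_entry Om L i j w).

Lemma commutator_entry Om L i j w :
  commutator (Om w) (L w) i j = bracket_entry Om L i j w.
Proof.
rewrite /commutator /bracket_entry !mxE -sumrB; apply: eq_bigr => k _.
by rewrite mulN1r [L w i k * _]mulrC.
Qed.

Lemma holomorphic_bracket Om L i j c :
  (forall i j, holomorphic (fun w => Om w i j) c) ->
  (forall i j, holomorphic (fun w => L w i j) c) ->
  holomorphic (bracket_entry Om L i j) c.
Proof.
move=> hO hL; apply: holomorphic_sum => k.
apply: (holomorphicD (holomorphicM (hO _ _) (hL _ _))).
exact: (holomorphicZ _ (holomorphicM (hO _ _) (hL _ _))).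
Qed.

Lemma holomorphic_nabla E Om L i j c : holomorphic E c ->
  (forall i j, holomorphic (fun w => Om w i j) c) ->
  (forall i j, holomorphic (fun w => L w i j) c) ->
  holomorphic (nabla_entry E Om L i j) c.
Proof.
move=> hE hO hL; apply: (holomorphicM hE).
apply: (holomorphicD (holomorphic_derive1 (hL i j))).
exact: (holomorphic_bracket i j hO hL).
Qed.

Lemma meromorphic_nabla E Om L i j c : meromorphic E c ->
  (forall i j, meromorphic (fun w => Om w i j) c) ->
  (forall i j, meromorphic (fun w => L w i j) c) ->
  meromorphic (nabla_entry E Om L i j) c.
Proof.
move=> hE hO hL; apply: (meromorphicM hE).
apply: (meromorphicD (meromorphic_derive1 (hL i j))).
apply: meromorphic_sum => k.
apply: (meromorphicD (meromorphicM (hO _ _) (hL _ _))).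
exact: (meromorphicZ _ (meromorphicM (hO _ _) (hL _ _))).
Qed.

(** The link between the analytic operation and the algebraic one on
    coefficients. *)
Lemma laurent_nabla E Om L c (e : int -> C) (w a : int -> M) i j :
  laurent_at 0 E c e ->
  (forall i j, laurent_at 1 (fun v => Om v i j) c (fun k => w k i j)) ->
  (forall i j, laurent_at 2 (fun v => L v i j) c (fun k => a k i j)) ->
  laurent_at 3 (nabla_entry E Om L i j) c
    (fun k => scale_coef e (nabla_coef w a) k i j).
Proof.
move=> hE hO hL.
have hB : laurent_at 3 (bracket_entry Om L i j) c (fun k => bracket_coef w a k i j).
  have := laurent_at_sum (index_enum 'I_n) (fun l =>
    laurent_atD (laurent_atM (hO i l) (hL l j))
      (laurent_atZ (-1) (laurent_atM (hO l j) (hL i l)))).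
  apply: laurent_at_eq => k.
  rewrite /laurent_conv /bracket_coef addnE /=.
  case: (k + 3) => N; last first.
    by rewrite mxE big1// => l _; rewrite mulr0 addr0.
  rewrite summxE; under eq_bigr => l _ do rewrite mulr_sumr -big_split /=.
  rewrite exchange_big /=; apply: eq_bigr => p _.
  rewrite /mxbracket !mxE -sumrB; apply: eq_bigr => l _.
  by rewrite mulN1r [a _ i l * _]mulrC.
have [_ hD] := laurent_at_derive (hL i j).
have := laurent_atM hE (laurent_atD hD hB).
apply: laurent_at_eq => k.
rewrite /laurent_conv /scale_coef addnE /=; case: (k + 3) => N; last by rewrite mxE.
rewrite summxE; apply: eq_bigr => p _.
by rewrite subr0 /nabla_coef !mxE.
Qed.

End LocalNabla.

(** * Independence of the chart *)

Section Charts.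
Variables (R : realType) (X : riemannSurface R).
Local Notation C := (CC R).
Implicit Types (phi psi : chart R X) (x p : X).

Lemma chart_at_atlas x : atlas (chart_at x).
Proof. by rewrite /chart_at; case: (cid _) => /= phi []. Qed.

Lemma chart_at_dom x : dom (chart_at x) x.
Proof. by rewrite /chart_at; case: (cid _) => /= phi []. Qed.

Lemma chart_coordK phi x : atlas phi -> dom phi x -> param phi (coord phi x) = x.
Proof. by move=> /atlas_chart[_ _ h _ _]; exact: h. Qed.

Lemma chart_near phi p (A : set X) : atlas phi -> dom phi p -> nbhs p A ->
  \forall w \near coord phi p,
    [/\ A (param phi w), dom phi (param phi w) & coord phi (param phi w) = w].
Proof.
move=> aphi dp pA; have [_ oU pK _ cp] := atlas_chart aphi.
rewrite (continuous_open_subspace _ oU) in cp.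
have cU : (coord phi @` dom phi) (coord phi p) by exists p.
have h1 : \forall w \near coord phi p, A (param phi w).
  by apply: (cp (coord phi p)); rewrite ?inE// pK.
have h2 : \forall w \near coord phi p, (coord phi @` dom phi) w.
  exact: (open_nbhs_nbhs (conj oU cU)).
apply: nbhs_mono2 h1 h2 => w Aw [y dy yw]; rewrite -yw in Aw *.
by rewrite !pK// in Aw *; rewrite pK.
Qed.

(** Points of a Hausdorff space are closed, so a finite set accumulates
    nowhere. *)
Lemma finite_avoid (S : set X) p : finite_set S -> nbhs p (~` (S `\ p)).
Proof.
move=> fS; apply: open_nbhs_nbhs; split; last by move=> [_ []].
have acc := hausdorff_accessible (@surface_hausdorff R X).
apply: closed_openC.
exact: (accessible_finite_set_closed.1 acc (S `\ p) (finite_setD _ fS)).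
Qed.

Lemma chart_near_regular phi p (S : set X) : finite_set S ->
  atlas phi -> dom phi p -> ~ S p ->
  \forall w \near coord phi p,
    [/\ ~ S (param phi w), dom phi (param phi w) & coord phi (param phi w) = w].
Proof.
move=> fS aphi dp Sp; apply: (chart_near (A := ~` S) aphi dp).
have := finite_avoid p fS; congr (nbhs p _); congr (~` _).
by apply/seteqP; split=> [x []//|x Sx]; split=> // xp; rewrite -xp in Sp.
Qed.

(** Here p may itself belong to S: the coordinate is injective on the chart,
    so w different from the coordinate of p excludes the point p itself. *)
Lemma chart_near_punctured phi p (S : set X) : finite_set S ->
  atlas phi -> dom phi p ->
  \forall w \near (coord phi p)^',
    [/\ ~ S (param phi w), dom phi (param phi w) & coord phi (param phi w) = w].
Proof.
move=> fS aphi dp.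
have := dnbhs_nbhs (chart_near aphi dp (finite_avoid p fS)).
apply: dnbhs_mono => w wc [h1 h2 h3]; split=> // Sw; apply: h1; split=> // xp.
by move: wc; rewrite -h3 xp eqxx.
Qed.

Section Invariance.
Variables (n : nat) (Se So : set X) (e : components X) (omega : mx_form X n).
Variable L : X -> 'M[C]_n.
Hypothesis he : mero_vector_field Se e.
Hypothesis ho : forall i j, mero_form So (fun phi x => omega phi x i j).

Definition nabla_chart phi x : 'M[C]_n :=
  \matrix_(i, j) nabla_entry (e phi \o param phi) (omega phi \o param phi)
    (L \o param phi) i j (coord phi x).

(** If T is the derivative of the change of coordinates from psi to phi, then
    e_phi = T e_psi, omega_psi = T omega_phi, and the derivative of L with
    respect to the coordinate of psi is T times the one with respect to that
    of phi. *)
Lemma nabla_chartE psi x : atlas psi -> dom psi x -> ~ Se x -> ~ So x ->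
  (forall i j, holomorphic_at (fun _ y => L y i j) x) ->
  nabla omega e L x = nabla_chart psi x.
Proof.
move=> apsi dpsi Sex Sox hL.
rewrite /nabla /vf_act /form_eval.
move: (chart_at x) (chart_at_atlas x) (chart_at_dom x) => phi aphi dphi.
pose T := derive1 (transition psi phi) (coord psi x).
have eE : e phi x = T * e psi x by case: he => _; apply.
have oE i j : omega psi x i j = T * omega phi x i j by case: (ho i j) => _; apply.
have LE i j : derive1 (fun w => L (param psi w) i j) (coord psi x) =
    derive1 (fun w => L (param phi w) i j) (coord phi x) * T.
  have hT : has_deriv (transition psi phi) (coord psi x) T.
    have [hT _] := atlas_compatible apsi aphi dpsi dphi.
    exact: (derivable_has_deriv (nbhs_singleton (holomorphic_derivable hT))).
  have hLx : has_deriv (fun w => L (param phi w) i j)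
      (transition psi phi (coord psi x)) 
      (derive1 (fun w => L (param phi w) i j) (coord phi x)).
    have -> : transition psi phi (coord psi x) = coord phi x.
      exact: (congr1 (coord phi) (chart_coordK apsi dpsi)).
    have hLij := holomorphic_derivable (hL i j phi aphi dphi).
    exact: (derivable_has_deriv (nbhs_singleton hLij)).
  have hc := has_deriv_comp hT hLx.
  rewrite -(has_derivE hc); apply: derive1_near.
  have od : open (dom phi) by case: (atlas_chart aphi).
  have := chart_near apsi dpsi (open_nbhs_nbhs (conj od dphi)).
  by apply: nbhs_mono => w [h1 h2 h3]; rewrite /= /transition /= chart_coordK.
apply/matrixP => i j; rewrite [RHS]mxE /nabla_entry /=.
rewrite -commutator_entry /= (chart_coordK apsi dpsi) LE.
rewrite /commutator -scalemxAl -scalemxAr !mxE eE.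
have -> : \sum_k omega psi x i k * L x k j = T * \sum_k omega phi x i k * L x k j.
  by rewrite mulr_sumr; apply: eq_bigr => k _; rewrite oE mulrA.
have -> : \sum_k L x i k * omega psi x k j = T * \sum_k L x i k * omega phi x k j.
  by rewrite mulr_sumr; apply: eq_bigr => k _; rewrite oE mulrCA.
by ring.
Qed.

End Invariance.
End Charts.

(** * The matrix Lie algebras as linear subspaces *)

Section LinearConditions.
Variables (F : numFieldType) (m : nat).
Local Notation M := 'M[F]_m.

Definition linear_functional (f : M -> F) : Prop :=
  forall k A B, f (k *: A + B) = k * f A + f B.

(** P is a linear subspace, given by equations. Equations pass to derivatives
    and to Laurent coefficients by linearity, whatever the Lie algebra. *)
Definition linear_condition (P : M -> Prop) : Prop :=
  exists (I : Type) (f : I -> M -> F),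
    (forall i, linear_functional (f i)) /\ forall A, P A <-> forall i, f i A = 0.

Lemma linear_functional_entries f : linear_functional f ->
  forall A, f A = \sum_i \sum_j f (delta_mx i j) * A i j.
Proof.
move=> lf.
have fD A B : f (A + B) = f A + f B by rewrite -[A]scale1r lf mul1r scale1r.
have f0 : f 0 = 0 by apply: (addrI (f 0)); rewrite -fD !addr0.
have fZ k A : f (k *: A) = k * f A by rewrite -[k *: A]addr0 lf f0 addr0.
have fS (I : Type) (s : seq I) (G : I -> M) :
    f (\sum_(i <- s) G i) = \sum_(i <- s) f (G i).
  by elim/big_rec2: _ => // i y x _ <-; rewrite fD.
move=> A; rewrite {1}(matrix_sum_delta A) fS; apply: eq_bigr => i _.
by rewrite fS; apply: eq_bigr => j _; rewrite fZ mulrC.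
Qed.

Lemma linear_conditionZ P k A : linear_condition P -> P A -> P (k *: A).
Proof.
move=> [I [f [lf fP]]] /fP PA; apply/fP => i.
rewrite (linear_functional_entries (lf i)).
under eq_bigr => p _ do under eq_bigr => q _ do rewrite mxE mulrCA.
under eq_bigr => p _ do rewrite -mulr_sumr.
by rewrite -mulr_sumr -(linear_functional_entries (lf i)) PA mulr0.
Qed.

Lemma linear_conditionD P A B : linear_condition P -> P A -> P B -> P (A + B).
Proof.
move=> [I [f [lf fP]]] /fP PA /fP PB; apply/fP => i.
by rewrite -[A]scale1r lf PA PB mulr0 addr0.
Qed.

(** A linear functional vanishing on L near c vanishes on the derivative,
    since it commutes with differentiation. *)
Lemma linear_condition_derive P (L : F -> M) c : linear_condition P ->
  (forall i j, derivable (fun w => L w i j) c 1) ->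
  (\forall w \near c, P (L w)) ->
  P (\matrix_(i, j) derive1 (fun w => L w i j) c).
Proof.
move=> [I [f [lf fP]]] dL PL; apply/fP => i.
rewrite (linear_functional_entries (lf i)).
have h : has_deriv (fun w => \sum_p \sum_q f i (delta_mx p q) * L w p q) c
    (\sum_p \sum_q f i (delta_mx p q) * derive1 (fun w => L w p q) c).
  apply: has_deriv_sum => p; apply: has_deriv_sum => q; apply: has_derivZ.
  exact: derivable_has_deriv.
under eq_bigr => p _ do under eq_bigr => q _ do rewrite mxE.
rewrite -(has_derivE h); apply: (has_derivE (f := fun w => _)).
apply: has_deriv_near (has_deriv_cst 0 c).
near=> w; rewrite -linear_functional_entries//; apply/esym.
by apply/(fP (L w)).1; near: w.
Unshelve. all: by end_near. Qed.

Lemma entry_lincomb k (A B : M) i j : (k *: A + B) i j = k * A i j + B i j.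
Proof. by rewrite !mxE. Qed.

Lemma lincomb_shuffle k c (A B P Q : M) :
  k *: ((c *: A + B) + (c *: P + Q)) = c *: (k *: (A + P)) + k *: (B + Q).
Proof. by apply/matrixP => i j; rewrite !mxE; ring. Qed.

(** The antisymmetrization behind [nabla_bracket]; A, B and D stand for N, N'
    and [Om, N]. *)
Lemma bracket_identity (a b a' b' : F) (A B D : M) :
  (a * b' - b * a') *: A =
  a *: (b' *: A + b *: B + b *: D) - b *: (a' *: A + a *: B + a *: D).
Proof. by apply/matrixP => i j; rewrite !mxE; ring. Qed.

End LinearConditions.

Section LieAlgebras.
Variables (R : realType) (n : nat).
Local Notation C := (CC R).

(** Applying a functional to L gives a function whose Laurent coefficients are
    the values of the functional on the coefficients of L; as it is zero, so
    are they. *)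
Lemma linear_condition_laurent m (P : 'M[C]_m -> Prop) (L : C -> 'M[C]_m) c N
    (a : int -> 'M[C]_m) : linear_condition P ->
  (forall i j, laurent_at N (fun w => L w i j) c (fun k => a k i j)) ->
  (\forall w \near c^', P (L w)) -> forall k, P (a k).
Proof.
move=> [I [f [lf fP]]] hL PL k; apply/fP => i.
rewrite (linear_functional_entries (lf i)).
have h := laurent_at_sum (index_enum 'I_m) (fun p =>
  laurent_at_sum (index_enum 'I_m) (fun q => laurent_atZ (f i (delta_mx p q)) (hL p q))).
apply: (@laurent_unique0 _ _ c (fun k => \sum_p \sum_q f i (delta_mx p q) * a k p q)).
  by apply/laurentP; exists N; exact: h.
apply: dnbhs_mono PL => w _ /fP/(_ i).
by rewrite (linear_functional_entries (lf i)).
Qed.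

Lemma so_linear m : linear_condition (fun A : 'M[C]_m => A^T = - A).
Proof.
exists ('I_m * 'I_m)%type, (fun ij A => A ij.2 ij.1 + A ij.1 ij.2); split.
  by move=> [i j] k A B; rewrite !mxE /=; ring.
move=> A; split=> [/matrixP h [i j]|h] /=.
  by have := h i j; rewrite !mxE => ->; rewrite addNr.
apply/matrixP => i j; rewrite !mxE; apply/eqP; rewrite -addr_eq0; apply/eqP.
exact: (h (i, j)).
Qed.

Lemma sp_linear m (sigma : 'M[C]_m) :
  linear_condition (fun A : 'M[C]_m => A^T *m sigma + sigma *m A = 0).
Proof.
exists ('I_m * 'I_m)%type, (fun ij A => (A^T *m sigma + sigma *m A) ij.1 ij.2); split.
  move=> [i j] k A B /=; rewrite linearD linearZ /= mulmxDl mulmxDr -scalemxAl -scalemxAr.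
  by rewrite !mxE; ring.
move=> A; split=> [-> [i j]|h]; first by rewrite mxE.
by apply/matrixP => i j; rewrite [RHS]mxE; exact: (h (i, j)).
Qed.

Lemma lie_mem_linear (G : matrix_lie R n) : linear_condition (@lie_mem R n G).
Proof.
case: G => [||| sigma|].
- by exists void, (fun _ _ => 0); split=> // -[].
- exists unit, (fun _ A => \tr A); split=> [_ k A B|A]; first by rewrite linearP.
  by split=> [h _ //|h]; exact: (h tt).
- exact: so_linear.
- exact: sp_linear.
- exists (bool * ('I_n * 'I_n))%type, (fun x (A : 'M[C]_n) =>
    if x.1 then A x.2.1 x.2.1 - A x.2.2 x.2.2
    else (x.2.1 != x.2.2)%:R * A x.2.1 x.2.2); split.
    by move=> [[] [i j]] k A B; rewrite !mxE /=; ring.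
  move=> A; split=> [/is_scalar_mxP[a ->] [b [i j]]|h] /=.
    by case: b; rewrite !mxE ?eqxx ?subrr//; case: eqVneq; rewrite ?mul0r ?mulr0.
  apply/is_scalar_mxP; case: (posnP n) => [n0|n0].
    exists 0; apply/matrixP => i; exfalso.
    by have := ltn_ord i; rewrite [X in (_ < X)%N]n0.
  exists (A (Ordinal n0) (Ordinal n0)); apply/matrixP => i j; rewrite mxE.
  case: eqVneq => [<-|ij].
    by have /= /eqP := h (true, (i, Ordinal n0)); rewrite subr_eq0 mulr1n => /eqP.
  by have := h (false, (i, j)); rewrite /= ij mul1r mulr0n.
Qed.

Lemma connection_mem_linear (G : matrix_lie R n) :
  linear_condition (@connection_mem R n G).
Proof.
have triv m : linear_condition (fun _ : 'M[C]_m => True).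
  by exists void, (fun _ _ => 0); split=> // -[].
case: G => [||| sigma|].
- exact: triv.
- exact: triv.
- exact: so_linear.
- exact: sp_linear.
- exact: triv.
Qed.

(** For sl(n) and scalar matrices omega may take any matrix value: the trace
    of a commutator vanishes, and scalar matrices are central. *)
Lemma lie_mem_commutator (G : matrix_lie R n) (A B : 'M[C]_(mdim G)) :
  connection_mem A -> lie_mem B -> lie_mem (commutator A B).
Proof.
rewrite /commutator; case: G A B => [||| sigma|] //= A B.
- by move=> _ _; rewrite linearB /= mxtrace_mulC subrr.
- by move=> hA hB; rewrite linearB /= !trmx_mul hA hB !mulmxN !mulNmx !opprK opprB.
- move=> /eqP; rewrite addr_eq0 => /eqP hA /eqP; rewrite addr_eq0 => /eqP hB.
  rewrite linearB /= !trmx_mul mulmxBl mulmxBr -!mulmxA hA hB !mulmxN !mulmxA hA hB.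
  by rewrite !mulNmx !opprK addrC addrA subrK subrr.
- move=> _ /is_scalar_mxP[c ->]; rewrite scalar_mxC subrr.
  by apply/is_scalar_mxP; exists 0; rewrite raddf0.
Qed.

End LieAlgebras.

Section Commutator.
Variables (R : realType) (m : nat).
Implicit Types A B D : 'M[CC R]_m.

Lemma commutatorZl k A B : commutator (k *: A) B = k *: commutator A B.
Proof. by rewrite /commutator -scalemxAl -scalemxAr scalerBr. Qed.

Lemma commutator_lincombr k A B D :
  commutator A (k *: B + D) = k *: commutator A B + commutator A D.
Proof.
rewrite /commutator mulmxDl mulmxDr -scalemxAl -scalemxAr scalerBr.
by rewrite opprD addrACA.
Qed.

Lemma commutatorZr k A B : commutator A (k *: B) = k *: commutator A B.
Proof. by rewrite /commutator -scalemxAl -scalemxAr scalerBr. Qed.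

End Commutator.

(** * The action of vector fields on Lax operators *)

Section OnTheSurface.
Variables (R : realType) (X : riemannSurface R) (n N : nat).
Local Notation C := (CC R).
Variables (Pplus Pminus : X) (gamma : 'I_N -> X) (z : 'I_N -> chart R X).
Variables (G : matrix_lie R n) (alpha : 'I_N -> 'cV[C]_(mdim G)).
Variable omega : mx_form X (mdim G).
Hypothesis hgammaP : forall s, gamma s <> Pplus /\ gamma s <> Pminus.
Hypothesis hz : forall s, local_coordinate (gamma s) (z s).
Hypothesis hG : well_formed G.
Hypothesis halpha : forall s, tyurin_vector (alpha s).
Hypothesis homega : connection_form Pminus gamma z alpha omega.
Local Notation S := (lax_singular Pplus Pminus gamma).
Local Notation VF := (KN_vector_field Pplus Pminus).
Local Notation gbar := (lax_operator Pplus Pminus gamma z alpha).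
Implicit Types (e f : components X) (L : X -> 'M[C]_(mdim G)).

Lemma lax_singular_finite : finite_set S.
Proof.
rewrite /lax_singular finite_setU; split; first exact: finite_image finite_finset.
by rewrite finite_setU; split; exact: finite_set1.
Qed.

Lemma regular_vf x : ~ S x -> ~ [set Pplus; Pminus] x.
Proof. by move=> h h'; apply: h; right. Qed.

Lemma regular_form x : ~ S x -> ~ connection_singular Pminus gamma x.
Proof. by move=> h [h'|h']; apply: h; [left|right; right]. Qed.

Lemma lax_holomorphic L x : gbar L -> ~ S x ->
  forall i j, holomorphic_at (fun _ y => L y i j) x.
Proof. by move=> [h _ _] Sx i j; case: (h i j) => _; apply. Qed.

Lemma form_holomorphic x : ~ S x ->
  forall i j, holomorphic_at (fun phi y => omega phi y i j) x.
Proof.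
move=> Sx i j; case: homega => h _ _; case: (h i j) => -[_ H] _.
exact: (H x (regular_form Sx)).
Qed.

Lemma vf_holomorphic e x : VF e -> ~ S x -> holomorphic_at e x.
Proof. by move=> [[_ H] _] Sx; exact: (H x (regular_vf Sx)). Qed.

Lemma nabla_local e L psi w i j : VF e -> gbar L -> atlas psi ->
  ~ S (param psi w) -> dom psi (param psi w) -> coord psi (param psi w) = w ->
  nabla omega e L (param psi w) i j =
  nabla_entry (e psi \o param psi) (omega psi \o param psi) (L \o param psi) i j w.
Proof.
move=> he hL apsi Sx dx cw; case: homega => ho _ _.
rewrite (nabla_chartE he ho apsi dx (regular_vf Sx) (regular_form Sx)).
  by rewrite mxE cw.
exact: (lax_holomorphic hL Sx).
Qed.

Lemma nabla_near_regular e L psi x i j : VF e -> gbar L -> atlas psi ->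
  dom psi x -> ~ S x ->
  \forall w \near coord psi x, nabla_entry (e psi \o param psi)
    (omega psi \o param psi) (L \o param psi) i j w = nabla omega e L (param psi w) i j.
Proof.
move=> he hL apsi dx Sx.
have := chart_near_regular lax_singular_finite apsi dx Sx.
apply: nbhs_mono => w [h1 h2 h3].
by rewrite (nabla_local _ _ he hL apsi h1 h2 h3).
Qed.

Lemma nabla_near_punctured e L psi x i j : VF e -> gbar L -> atlas psi ->
  dom psi x ->
  \forall w \near (coord psi x)^', nabla_entry (e psi \o param psi)
    (omega psi \o param psi) (L \o param psi) i j w = nabla omega e L (param psi w) i j.
Proof.
move=> he hL apsi dx.
have := chart_near_punctured lax_singular_finite apsi dx.
apply: dnbhs_mono => w _ [h1 h2 h3].
by rewrite (nabla_local _ _ he hL apsi h1 h2 h3).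
Qed.

(** Order 2 occurs only for sp(2n); a common bound lets one Laurent
    computation serve all the algebras. *)
Lemma lax_expansion_pole (a : int -> 'M[C]_(mdim G)) s :
  lax_expansion (alpha s) a -> forall k : int, k < -2 -> a k = 0.
Proof.
move: (alpha s) a; case: (G) => [||| sigma|] /= al a; rewrite /pole_order_le.
- by move=> [h _] k k2; apply: h; lia.
- by move=> [h _] k k2; apply: h; lia.
- by move=> [h _] k k2; apply: h; lia.
- by move=> [h _] k k2; apply: h; lia.
- by move=> h k k2; apply: h; lia.
Qed.

Lemma connection_expansion_pole (w : int -> 'M[C]_(mdim G)) s :
  connection_expansion (alpha s) w -> forall k : int, k < -1 -> w k = 0.
Proof.
move=> [h0 h1] k k1; have [al|/eqP al] := eqVneq (alpha s) 0.
  by apply: (h0 al); lia.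
by have [h _] := h1 al; apply: h; lia.
Qed.

Lemma nabla_entry_regular L e psi x i j : VF e -> gbar L -> atlas psi ->
  dom psi x -> ~ S x ->
  holomorphic (nabla_entry (e psi \o param psi)
    (omega psi \o param psi) (L \o param psi) i j) (coord psi x).
Proof.
move=> he hL apsi dx Sx; apply: holomorphic_nabla.
- exact: (vf_holomorphic he Sx apsi dx).
- move=> p q; exact: (form_holomorphic Sx p q apsi dx).
- move=> p q; exact: (lax_holomorphic hL Sx p q apsi dx).
Qed.

Lemma nabla_lie_mem e L x : VF e -> gbar L -> ~ S x -> lie_mem (nabla omega e L x).
Proof.
move=> he hL Sx; rewrite /nabla /vf_act /form_eval.
move: (chart_at x) (chart_at_atlas x) (chart_at_dom x) => phi aphi dphi.
case: (hL) => _ LL _; case: homega => _ LO _.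
apply: (linear_conditionD (lie_mem_linear G)).
  apply: (linear_conditionZ _ (lie_mem_linear G)).
  apply: (linear_condition_derive (L := L \o param phi) (lie_mem_linear G)).
    move=> i j.
    exact: (nbhs_singleton (holomorphic_derivable (lax_holomorphic hL Sx i j aphi dphi))).
  have := chart_near_regular lax_singular_finite aphi dphi Sx.
  by apply: nbhs_mono => w [h _ _]; exact: LL.
apply: lie_mem_commutator; last exact: LL.
apply: (linear_conditionZ _ (connection_mem_linear G)).
exact: (LO phi x aphi dphi (regular_form Sx)).
Qed.

Lemma nabla_lax e L : VF e -> gbar L -> gbar (nabla omega e L).
Proof.
move=> he hL; case: (hL) => Lm LL Lx; case: (homega) => om oL ox; split.
- move=> i j; split=> [p psi apsi dp|p Sp psi apsi dp].
    apply: (meromorphic_near (nabla_near_punctured i j he hL apsi dp)).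
    apply: meromorphic_nabla.
    + by case: he => -[H _] _; exact: (H p psi apsi dp).
    + by move=> k l; case: (om k l) => -[H _] _; exact: (H p psi apsi dp).
    + by move=> k l; case: (Lm k l) => H _; exact: (H p psi apsi dp).
  apply: (holomorphic_near (nabla_near_regular i j he hL apsi dp Sp)).
  exact: (nabla_entry_regular i j he hL apsi dp Sp).
- by move=> x Sx; exact: nabla_lie_mem.
- move=> s; have [a [La ha]] := Lx s; have [w [Lw hw]] := ox s.
  have [az dz cz] := hz s.
  have he0 : holomorphic (e (z s) \o param (z s)) 0.
    have nP : ~ [set Pplus; Pminus] (gamma s) by move=> [] h; case: (hgammaP s).
    by rewrite -cz; case: he => -[_ H] _; exact: (H _ nP _ az dz).
  have [ee hee] := holomorphic_laurent he0.
  have La2 i j : laurent_at 2 (fun v => (L \o param (z s)) v i j) 0 (fun k => a k i j).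
    by apply: (laurent_reindex (La i j)) => k k2; rewrite (lax_expansion_pole ha) ?mxE.
  have Lw1 i j : laurent_at 1 (fun v => (omega (z s) \o param (z s)) v i j) 0
      (fun k => w k i j).
    by apply: (laurent_reindex (Lw i j)) => k k2; rewrite (connection_expansion_pole hw) ?mxE.
  have near0 := chart_near_punctured lax_singular_finite az dz.
  rewrite cz in near0.
  exists (scale_coef ee (nabla_coef w a)); split.
    move=> i j; apply/laurentP; exists 3%N.
    have := nabla_near_punctured i j he hL az dz; rewrite cz => hn.
    exact: (laurent_at_near hn (laurent_nabla i j hee Lw1 La2)).
  apply: lax_expansion_stable => //.
  + apply: (linear_condition_laurent (lie_mem_linear G) La2).
    by apply: dnbhs_mono near0 => v _ [h _ _]; exact: LL.
  + apply: (linear_condition_laurent (connection_mem_linear G) Lw1).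
    by apply: dnbhs_mono near0 => v _ [h1 h2 _]; exact: (oL _ _ az h2 (regular_form h1)).
Qed.

Lemma nabla_scale e L x : nabla omega e L x = e (chart_at x) x *:
  (\matrix_(i, j) derive1 (fun w => L (param (chart_at x) w) i j) (coord (chart_at x) x) +
   commutator (omega (chart_at x) x) (L x)).
Proof.
rewrite scalerDr -commutatorZl.
exact: erefl.
Qed.

Lemma nabla_vf_lincomb c e f L x :
  nabla omega (vf_lincomb c e f) L x = c *: nabla omega e L x + nabla omega f L x.
Proof. by rewrite !nabla_scale /vf_lincomb scalerDl scalerA. Qed.

Lemma nabla_lincomb c e L M x : gbar L -> gbar M -> ~ S x ->
  nabla omega e (fun y => c *: L y + M y) x = c *: nabla omega e L x + nabla omega e M x.
Proof.
move=> hL hM Sx; rewrite !nabla_scale.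
move: (chart_at x) (chart_at_atlas x) (chart_at_dom x) => phi aphi dphi.
have E i j :
  derive1 (fun w => (c *: L (param phi w) + M (param phi w)) i j) (coord phi x) =
  c * derive1 (fun w => L (param phi w) i j) (coord phi x) +
  derive1 (fun w => M (param phi w) i j) (coord phi x).
  have dL := nbhs_singleton (holomorphic_derivable (lax_holomorphic hL Sx i j aphi dphi)).
  have dM := nbhs_singleton (holomorphic_derivable (lax_holomorphic hM Sx i j aphi dphi)).
  have hcL := has_derivZ c (derivable_has_deriv dL).
  rewrite -(has_derivE (has_derivD hcL (derivable_has_deriv dM))).
  by apply: derive1_near; apply: nbhs_all => w; exact: entry_lincomb.
rewrite commutator_lincombr -lincomb_shuffle; congr (_ *: (_ + _)).
by apply/matrixP => i j; rewrite entry_lincomb [LHS]mxE E; congr (_ * _ + _); rewrite mxE.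
Qed.

(** On components, nabla_e L = E N where N = dL/dz + [Om, L] does not involve
    e. *)
Lemma nabla_bracket e f L x : VF e -> VF f -> gbar L -> ~ S x ->
  nabla omega (vf_bracket e f) L x =
  nabla omega e (nabla omega f L) x - nabla omega f (nabla omega e L) x.
Proof.
move=> he hf hL Sx.
pose phi := chart_at x; have aphi := chart_at_atlas x; have dphi := chart_at_dom x.
rewrite -/phi in aphi dphi.
pose c := coord phi x.
pose Nv i j (w : C) := derive1 (fun v => L (param phi v) i j) w +
  bracket_entry (omega phi \o param phi) (L \o param phi) i j w.
pose N0 : 'M[C]_(mdim G) := \matrix_(i, j) Nv i j c.
pose N1 : 'M[C]_(mdim G) := \matrix_(i, j) derive1 (Nv i j) c.
have xc : param phi c = x := chart_coordK aphi dphi.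
have nablaE g : nabla omega g L x = g phi x *: N0.
  rewrite nabla_scale -/phi; congr (_ *: _); apply/matrixP => i j.
  by rewrite [RHS]mxE /Nv -commutator_entry /= xc 2!mxE.
have Nd i j : derivable (Nv i j) c 1.
  apply: (nbhs_singleton (holomorphic_derivable _)).
  apply: holomorphicD.
    exact: (holomorphic_derive1 (lax_holomorphic hL Sx i j aphi dphi)).
  apply: holomorphic_bracket => p q.
    exact: (form_holomorphic Sx p q aphi dphi).
  exact: (lax_holomorphic hL Sx p q aphi dphi).
have nabla2 g h : VF g -> VF h -> nabla omega g (nabla omega h L) x =
    g phi x *: (derive1 (h phi \o param phi) c *: N0 + h phi x *: N1 +
      h phi x *: commutator (omega phi x) N0).
  move=> hg hh.
  have dh := nbhs_singleton (holomorphic_derivable (vf_holomorphic hh Sx aphi dphi)).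
  have E i j : derive1 (fun w => nabla omega h L (param phi w) i j) c =
      derive1 (h phi \o param phi) c * Nv i j c + h phi x * derive1 (Nv i j) c.
    rewrite -[in h phi x]xc.
    have hN := derivable_has_deriv (Nd i j).
    rewrite -(has_derivE (has_derivM (derivable_has_deriv dh) hN)).
    apply: derive1_near.
    apply: nbhs_mono (nabla_near_regular i j hh hL aphi dphi Sx) => w <-.
    by [].
  rewrite nabla_scale -/phi nablaE commutatorZr; congr (_ *: (_ + _)).
  by apply/matrixP => i j; rewrite entry_lincomb [LHS]mxE E !mxE.
rewrite nablaE (nabla2 _ _ he hf) (nabla2 _ _ hf he) /vf_bracket -/c.
exact: bracket_identity.
Qed.

End OnTheSurface.

Theorem proposition2p7 (R : realType) (X : riemannSurface R) (g n : nat)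
    (hcompact : compact [set: X]) (hgenus : has_genus X g)
    (Pplus Pminus : X) (hP : Pplus <> Pminus)
    (gamma : 'I_(n * g) -> X) (hgamma : injective gamma)
    (hgammaP : forall s, gamma s <> Pplus /\ gamma s <> Pminus)
    (z : 'I_(n * g) -> chart R X)
    (hz : forall s, local_coordinate (gamma s) (z s))
    (G : matrix_lie R n) (hG : well_formed G)
    (alpha : 'I_(n * g) -> 'cV[CC R]_(mdim G))
    (halpha : forall s, tyurin_vector (alpha s))
    (omega : mx_form X (mdim G))
    (homega : connection_form Pminus gamma z alpha omega) :
  let VF := KN_vector_field Pplus Pminus in
  let gbar := lax_operator Pplus Pminus gamma z alpha in
  let D := nabla omega in
  let eq_mero (L M : X -> 'M[CC R]_(mdim G)) :=
    forall x, ~ lax_singular Pplus Pminus gamma x -> L x = M x in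
  [/\ forall e L, VF e -> gbar L -> gbar (D e L),
      forall c e f L, VF e -> VF f -> gbar L ->
        eq_mero (D (vf_lincomb c e f) L) (fun x => c *: D e L x + D f L x),
      forall c e L M, VF e -> gbar L -> gbar M ->
        eq_mero (D e (fun x => c *: L x + M x))
                (fun x => c *: D e L x + D e M x) &
      forall e f L, VF e -> VF f -> gbar L ->
        eq_mero (D (vf_bracket e f) L)
                (fun x => D e (D f L) x - D f (D e L) x)].
Proof.
move=> VF gbar D eq_mero; split.
- by move=> e L he hL; exact: (nabla_lax hgammaP hz hG halpha homega he hL).
- by move=> c e f L _ _ _ x _; exact: nabla_vf_lincomb.
- by move=> c e L M _ hL hM x Sx; exact: (nabla_lincomb omega c e hL hM Sx).
- by move=> e f L he hf hL x Sx; exact: (nabla_bracket homega he hf hL Sx).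
Qed.
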